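(* Let $d\ge 3$. Then any linear automorphism ${\bf A}$ of $L_{d,d+2}$ is a scalar multiple of a signed permutation induced by a vertex relabeling, i.e., ${\bf A}=c\,{\bf S}{\bf P}$ with $c\in\mathbb C\setminus\{0\}$, ${\bf S}$ diagonal with entries $\pm1$, and ${\bf P}$ a permutation matrix sending $e_{\{i,j\}}$ to $e_{\{\sigma(i),\sigma(j)\}}$ for some permutation $\sigma$ of $\{1,\dots,d+2\}$.
   Context: Let $n=d+2$, $N=\binom n2$, and index coordinates of $\mathbb C^N$ by edges $\{i,j\}$ of $K_n$. For a complex configuration ${\bf p}$ of $n$ points in $\mathbb C^d$, $m({\bf p})\in\mathbb C^N$ has coordinates $m_{ij}({\bf p})=\sum_{k=1}^d({\bf p}_i^k-{\bf p}_j^k)^2$ (no conjugation); $M_{d,n}$ is the image of $m$; $L_{d,n}=s^{-1}(M_{d,n})$ with $s$ the coordinatewise squaring map. A linear automorphism of $L_{d,n}$ is a non-singular $N\times N$ complex matrix mapping $L_{d,n}$ bijectively onto itself. *)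

(* Defs.v *)
(* complex numbers are [R[i]] (mathcomp-real-closed) for
   [R : realType] (mathcomp-reals), i.e. C when R is the real numbers. *)
From HB Require Import structures.
From mathcomp Require Import all_boot all_order all_algebra.
From mathcomp Require Import complex.
From mathcomp Require Import reals.
From mathcomp Require Import fingroup perm.
Set Implicit Arguments. Unset Strict Implicit. Unset Printing Implicit Defensive.
Import Order.TTheory GRing.Theory Num.Theory.
Local Open Scope ring_scope.

(* Edges {i,j} of K_n, represented by the ordered pair (i,j) with i < j. *)
Definition edge (n : nat) := {ij : 'I_n * 'I_n | (ij.1 < ij.2)%N}.

(* Vectors of C^N (N = binom n 2) are functions on edges; an N x N matrix is
   a function of two edges (row, column). *)
Definition cvec (R : realType) (n : nat) := edge n -> R[i].
Definition cmat (R : realType) (n : nat) := edge n -> edge n -> R[i].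

Definition mat_apply (R : realType) (n : nat) (A : cmat R n) (v : cvec R n)
  : cvec R n := fun e => \sum_(f : edge n) A e f * v f.

Definition nonsingular (R : realType) (n : nat) (A : cmat R n) : Prop :=
  forall v w : cvec R n, mat_apply A v = mat_apply A w -> v = w.

Definition config (R : realType) (d n : nat) := 'I_n -> 'I_d -> R[i].

(* m_{ij}(p) = sum_k (p_i^k - p_j^k)^2, no conjugation *)
Definition mmap (R : realType) (d n : nat) (p : config R d n) : cvec R n :=
  fun e => \sum_(k < d) (p (val e).1 k - p (val e).2 k) ^+ 2.

Definition Mset (R : realType) (d n : nat) (x : cvec R n) : Prop :=
  exists p : config R d n, x = mmap p.

Definition sq (R : realType) (n : nat) (y : cvec R n) : cvec R n :=
  fun e => y e ^+ 2.

Definition Lset (R : realType) (d n : nat) (y : cvec R n) : Prop :=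
  Mset d (sq y).

Definition lin_aut (R : realType) (d n : nat) (A : cmat R n) : Prop :=
  [/\ nonsingular A,
      (forall y, Lset d y -> Lset d (mat_apply A y))
    & (forall z, Lset d z -> exists2 y, Lset d y & mat_apply A y = z)].

(* entry (e,f) of the permutation matrix P_sigma sending e_f to e_{sigma(f)} *)
Definition perm_edge_entry (R : realType) (n : nat) (s : {perm 'I_n})
  (e f : edge n) : R[i] :=
  (((s (val f).1, s (val f).2) == val e) ||
   ((s (val f).2, s (val f).1) == val e))%:R.

(* Main.v *)
(* A vector [y] lies in [L] iff the quadratic form [\sum y_ij^2 w_i w_j] is
   degenerate on [\sum w_i = 0].  Call a direction [u] special if no line
   [v + s u] that is not contained in [L] meets [L] in three points; a linear
   automorphism preserves special directions.  A vector with entries +-1 on the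
   edges at one vertex and 0 elsewhere is special: along it the determinant of
   the form has degree 2.  Conversely, making the edges avoiding a triangle
   large (this needs two further vertices, so n >= 5) degenerates the
   determinant to Heron's product of four linear factors on that triangle, so
   on each triangle a special vector has one zero entry and two entries with
   equal squares.  Hence it is supported on a cut, with entries of constant
   square, and an explicit line excludes cuts with two vertices on both sides.
   So an automorphism permutes the signed stars up to scaling.  Varying one sign
   at a time shows that the centre of the image depends only on the centre,
   which gives the vertex permutation, and the constant squares give the common
   scalar. *)
Require Import Defs.
From HB Require Import structures.
From mathcomp Require Import all_boot all_order all_algebra.
From mathcomp Require Import complex.
From mathcomp Require Import reals.
From mathcomp Require Import fingroup perm.
From mathcomp Require Import boolp ring zify.
Set Implicit Arguments. Unset Strict Implicit. Unset Printing Implicit Defensive.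
Import Order.TTheory GRing.Theory Num.Theory.
Local Open Scope ring_scope.

(** * Degenerate bordered forms *)

(** A nonzero diagonal entry is attained on a basis vector. If the diagonal vanishes, a nonzero
    entry [S i j] gives the value [2 * S i j] on the sum of two basis vectors, and 2 is
    invertible. *)
Lemma symmetric_mx_anisotropic (F : numFieldType) n (S : 'M[F]_n) :
  S^T = S -> S != 0 -> exists v : 'rV_n, (v *m S *m v^T) 0 0 != 0.
Proof.
move=> symS /eqP nzS.
have bil i j : ((delta_mx 0 i : 'rV_n) *m S *m (delta_mx 0 j : 'rV_n)^T) 0 0 = S i j.
  by rewrite -rowE trmx_delta -colE !mxE.
have [/existsP[i Si]|noi] := boolP [exists i, S i i != 0].
  by exists (delta_mx 0 i); rewrite bil.
have diag k : S k k = 0.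
  by apply/eqP/negPn/negP => Sk; case/existsP: noi; exists k.
have [/existsP[i /existsP[j Sij]]|noij] :=
  boolP [exists i, exists j, S i j != 0]; last first.
  case: nzS; apply/matrixP => i j; rewrite mxE; apply/eqP/negPn/negP => Sij.
  by case/existsP: noij; exists i; apply/existsP; exists j.
exists (delta_mx 0 i + delta_mx 0 j).
rewrite linearD /= mulmxDl mulmxDr !mulmxDl !mxE.
move: (bil i i) (bil i j) (bil j i) (bil j j); rewrite !mxE => -> -> -> ->.
have -> : S j i = S i j by rewrite -[in LHS]symS mxE.
by rewrite !diag add0r addr0 -mulr2n mulrn_eq0 /= Sij.
Qed.

(** Lagrange reduction: subtracting the square [c^-1 *: (w^T *m w)] attached to an anisotropic [v]
    puts [v] in the kernel and strictly shrinks the row space, while a square root absorbs the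
    coefficient. The rows of [P] will serve as points with a prescribed Gram matrix. *)
Lemma symmetric_mx_factor (F : numClosedFieldType) n r (S : 'M[F]_n) :
  S^T = S -> (\rank S <= r)%N -> exists P : 'M_(n, r), S = P *m P^T.
Proof.
elim: r S => [|r IHr] S symS rkS.
  exists 0; rewrite mul0mx; apply/eqP.
  by rewrite -mxrank_eq0 -leqn0.
have [->|nzS] := eqVneq S 0; first by exists 0; rewrite mul0mx.
have [v cN0] := symmetric_mx_anisotropic symS nzS.
set w := v *m S in cN0; set c := (w *m v^T) 0 0 in cN0.
have Sv : S *m v^T = w^T by rewrite trmx_mul symS.
set S' := S - c^-1 *: (w^T *m w).
have symS' : S'^T = S'.
  by rewrite /S' linearB linearZ /= trmx_mul trmxK symS.
have S'v : S' *m v^T = 0.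
  rewrite /S' mulmxBl Sv -scalemxAl -mulmxA (mx11_scalar (w *m v^T)) -/c.
  by rewrite mul_mx_scalar scalerA mulVf // scale1r subrr.
have leS : (S' <= S)%MS.
  rewrite /S' addmx_sub // eqmx_opp scalemx_sub //.
  by rewrite mulmxA submxMl.
have ltS : (S' < S)%MS.
  rewrite /ltmx leS /=; apply: contra cN0 => /submxP[D defS].
  have : w^T = 0 by rewrite -Sv defS -mulmxA S'v mulmx0.
  move/(congr1 trmx); rewrite trmxK linear0 => w0.
  by rewrite /c w0 mul0mx mxE.
have rkS' : (\rank S' <= r)%N.
  by rewrite -ltnS (leq_trans _ rkS) //; move: ltS; rewrite ltmxErank => /andP[].
have [P' defP'] := IHr _ symS' rkS'.
pose P : 'M_(n, 1 + r) := row_mx (sqrtC c^-1 *: w^T) P'.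
suff defP : P *m P^T = S by exists P; exact: esym.
rewrite tr_row_mx mul_row_col -defP' linearZ /= trmxK -scalemxAl -scalemxAr.
by rewrite scalerA -expr2 sqrtCK /S' addrC subrK.
Qed.

(** For symmetric [X], the vector [w] lies in the radical of the form restricted to the hyperplane
    orthogonal to [h], and [t] is a Lagrange multiplier. A general [h] is kept because rescaling the
    vertices changes the border. *)
Definition degenerate (F : fieldType) n (X : 'I_n -> 'I_n -> F) (h : 'I_n -> F)
  : Prop :=
  exists2 w : 'I_n -> F, exists i, w i != 0 &
    \sum_i h i * w i = 0 /\
    exists t, forall i, \sum_j X i j * w j = t * h i.

(** With [h = 1] and squared distances for [X], this is the Cayley-Menger matrix. *)
Definition bordered (F : pzRingType) n (X : 'I_n -> 'I_n -> F) (h : 'I_n -> F)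
  : 'M[F]_(1 + n) :=
  block_mx 0 (\row_i h i) (\col_i h i) (\matrix_(i, j) X i j).

(** A pair [w], [t] corresponds to the kernel vector [(- t, w)]. Since [h] is nonzero, a kernel
    vector with [w = 0] also has first entry 0. *)
Lemma degenerate_det (F : fieldType) n (X : 'I_n -> 'I_n -> F) (h : 'I_n -> F) :
  (exists i, h i != 0) -> degenerate X h <-> \det (bordered X h) = 0.
Proof.
move=> [i0 hi0]; split.
  case=> w [k wk] [hw [t Xw]]; apply/eqP; rewrite -det_tr; apply/det0P.
  exists (row_mx (- t)%:M (\row_i w i)).
    apply: contraNneq wk => /(congr1 rsubmx); rewrite row_mxKr linear0.
    by move/rowP/(_ k); rewrite !mxE => ->.
  rewrite tr_block_mx mul_row_block !(trmx0, mulmx0, add0r).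
  have -> : \row_i w i *m (\row_i h i)^T = 0.
    apply/matrixP => i j; rewrite !mxE -[RHS]hw.
    by apply: eq_bigr => l _; rewrite !mxE mulrC.
  apply/eqP; rewrite -[X in _ == X]row_mx0; apply/eqP; congr row_mx.
  apply/rowP => i; rewrite mul_scalar_mx !mxE.
  under eq_bigr do rewrite !mxE mulrC.
  by rewrite Xw mulNr addNr.
move/eqP; rewrite -det_tr => /det0P[v nzv].
rewrite -[v]hsubmxK tr_block_mx mul_row_block !(trmx0, mulmx0, add0r).
set a := lsubmx v; set b := rsubmx v => E.
have Eb : b *m (\row_i h i)^T = 0.
  by move/(congr1 lsubmx): E; rewrite row_mxKl linear0.
have Ea : a *m (\col_i h i)^T + b *m (\matrix_(i, j) X i j)^T = 0.
  by move/(congr1 rsubmx): E; rewrite row_mxKr linear0.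
have EX i : \sum_j X i j * b 0 j = - a 0 0 * h i.
  apply/eqP; rewrite mulNr -addr_eq0; apply/eqP.
  move/rowP/(_ i): Ea; rewrite [in RHS]mxE => E0; rewrite -[RHS]E0 !mxE big_ord1 !mxE addrC.
  by congr (_ + _); apply: eq_bigr => l _; rewrite !mxE mulrC.
exists (b 0) => //; last first.
  split; last by exists (- a 0 0).
  move/matrixP/(_ 0 0): Eb; rewrite [in RHS]mxE => E0; rewrite -[RHS]E0 !mxE.
  by apply: eq_bigr => l _; rewrite !mxE mulrC.
apply/existsP; rewrite -[[exists x, _]]negbK negb_exists.
apply/negP => /forallP b0.
have {}b0 : b = 0 by apply/rowP => i; rewrite [RHS]mxE; apply/eqP/negPn; exact: b0.
case/negP: nzv; rewrite -[v]hsubmxK -/a -/b b0.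
suff -> : a = 0 by rewrite row_mx0.
apply/matrixP => i j; rewrite !ord1 [RHS]mxE; apply/eqP.
have := EX i0; rewrite b0 big1 => [/esym/eqP|l _]; last by rewrite mxE mulr0.
by rewrite mulf_eq0 oppr_eq0 (negPf hi0) orbF.
Qed.

Lemma map_bordered (F G : pzRingType) (f : {rmorphism F -> G}) n
    (X : 'I_n -> 'I_n -> F) (h : 'I_n -> F) :
  map_mx f (bordered X h) = bordered (fun i j => f (X i j)) (fun i => f (h i)).
Proof.
rewrite /bordered map_block_mx map_mx0; congr block_mx;
  by apply/matrixP => i j; rewrite !mxE.
Qed.

Lemma eq_degenerate (F : fieldType) n (X Y : 'I_n -> 'I_n -> F) (h k : 'I_n -> F) :
  (forall i j, X i j = Y i j) -> h =1 k -> degenerate X h -> degenerate Y k.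
Proof.
move=> XY hk [w nzw [hw [t Xw]]]; exists w => //; split.
  by rewrite -[RHS]hw; apply: eq_bigr => i _; rewrite hk.
by exists t => i; rewrite -hk -Xw; apply: eq_bigr => j _; rewrite XY.
Qed.

(* On the hyperplane [\sum_i w i = 0] the form of [g i + g j] has constant
   value vector. *)
Lemma degenerate_shift (F : fieldType) n (X : 'I_n -> 'I_n -> F) (g : 'I_n -> F) :
  degenerate X (fun=> 1) -> degenerate (fun i j => X i j + g i + g j) (fun=> 1).
Proof.
case=> w nzw [hw [t Xw]]; exists w => //; split=> //.
exists (t + \sum_j g j * w j) => i; rewrite mulr1.
under eq_bigr do rewrite !mulrDl.
rewrite !big_split /= Xw mulr1 -addrA; congr (_ + _).
rewrite -mulr_sumr (_ : \sum_j w j = 0) ?mulr0 ?add0r //.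
by rewrite -[RHS]hw; apply: eq_bigr => j _; rewrite mul1r.
Qed.

Lemma degenerate_scale (F : fieldType) n (X : 'I_n -> 'I_n -> F) (h : 'I_n -> F)
    (l : 'I_n -> F) (c : F) :
  c != 0 -> (forall i, l i != 0) ->
  degenerate X h -> degenerate (fun i j => l i * X i j * l j) (fun i => c * l i * h i).
Proof.
move=> c0 l0 [w [k wk] [hw [t Xw]]].
exists (fun i => w i / l i).
  by exists k; rewrite mulf_neq0 ?invr_neq0.
split.
  rewrite -[RHS](mulr0 c) -[in RHS]hw mulr_sumr.
  by apply: eq_bigr => i _; field.
exists (t / c) => i; transitivity (l i * \sum_j X i j * w j).
  by rewrite mulr_sumr; apply: eq_bigr => j _; field.
by rewrite Xw; field.
Qed.

(** * Perturbation of three distinct roots *)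

(** The logarithmic derivative of [q] has only simple poles, at the roots of [q], so a factor [B]
    vanishing there clears them. *)
Lemma prod_XsubC_dvd_log_derivative (F : fieldType) (rs : seq F) (B : {poly F}) :
  (forall r, r \in rs -> root B r) ->
  let q := \prod_(r <- rs) ('X - r%:P) in q %| B * q^`().
Proof.
move=> rootB /=; elim: rs rootB => [|r rs IHrs] rootB.
  by rewrite big_nil dvd1p.
rewrite big_cons derivM derivXsubC mul1r mulrDr dvdp_add //.
  by rewrite dvdp_mul // dvdp_XsubCl rootB ?mem_head.
rewrite mulrCA dvdp_mul //; apply: IHrs => t ts.
by rewrite rootB // inE ts orbT.
Qed.

(** With at most two distinct roots, [B] is the product of the linear factors over these roots,
    taken once each, and [A] is the quotient, of smaller degree. *)
Lemma distinct_roots_log_derivative (F : closedFieldType) (q : {poly F}) :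
  q != 0 ->
  (exists s : seq F, [/\ size s = 3, uniq s & all (root q) s]) \/
  exists B A : {poly F},
    [/\ B != 0, (size B <= 3)%N, (size A <= 2)%N & B * q^`() = A * q].
Proof.
move=> q0; have [rs defq] := closed_field_poly_normal q.
have lc0 : lead_coef q != 0 by rewrite lead_coef_eq0.
have rootq r : root q r = (r \in rs).
  by rewrite defq rootZ // root_prod_XsubC.
have [le3|lt3] := leqP 3 (size (undup rs)).
  left; exists (take 3 (undup rs)); split.
  - by rewrite size_takel.
  - by rewrite take_uniq // undup_uniq.
  - by apply/allP => r /mem_take; rewrite mem_undup rootq.
right; pose B := \prod_(r <- undup rs) ('X - r%:P).
have sB : size B = (size (undup rs)).+1 by rewrite size_prod_XsubC.
have B0 : B != 0 by rewrite -size_poly_gt0 sB.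
have dvd : q %| B * q^`().
  rewrite [in X in X %| _]defq [in X in _ %| X]defq derivZ -scalerAr.
  rewrite dvdpZl // dvdpZr //; apply: prod_XsubC_dvd_log_derivative => r rrs.
  by rewrite root_prod_XsubC mem_undup.
exists B, (B * q^`() %/ q); split=> //; first by rewrite sB.
  rewrite size_divp // leq_subLR.
  have := size_polyMleq B q^`(); have := lt_size_deriv q0.
  rewrite sB; move: (size (B * _)) (size q^`()) (size q) (size (undup rs)) lt3.
  by move=> a b c e; lia.
by rewrite divpK.
Qed.

Definition log_rows (K : comNzRingType) (q : {poly K}) (k : 'I_5) : {poly K} :=
  if (k < 3)%N then 'X^k * q^`() else 'X^(k - 3) * q.

Definition log_mx (K : comNzRingType) (q : {poly K}) D : 'M[K]_(5, D) :=
  \matrix_(k, i) (log_rows q k)`_i.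

Lemma mul_log_mx (F : fieldType) (q B A : {poly F}) D (v : 'rV_5) :
  (size B <= 3)%N -> (size A <= 2)%N ->
  (forall k : 'I_5, v 0 k = if (k < 3)%N then B`_k else A`_(k - 3)) ->
  v *m log_mx q D = poly_rV (B * q^`() + A * q).
Proof.
move=> sB sA defv; apply/rowP => i; rewrite !mxE.
have -> : B = \sum_(k < 3) B`_k *: 'X^k.
  by rewrite -poly_def; apply/polyP => k; rewrite coef_poly; case: ltnP => // le; rewrite nth_default // (leq_trans sB).
have -> : A = \sum_(k < 2) A`_k *: 'X^k.
  by rewrite -poly_def; apply/polyP => k; rewrite coef_poly; case: ltnP => // le; rewrite nth_default // (leq_trans sA).
under eq_bigr do rewrite mxE defv -coefZ.
rewrite -coef_sum !mulr_suml; congr (_`_ _).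
rewrite !big_ord_recl !big_ord0 /log_rows /= !addr0 -!addrA.
by rewrite /bump /= -!scalerAl.
Qed.

(** In characteristic 0 the order of vanishing at [r] drops by exactly one from [q] to its
    derivative, so [B] must supply the missing factor. *)
Lemma log_derivative_root (F : numFieldType) (q B A : {poly F}) (r : F) :
  q != 0 -> root q r -> B * q^`() + A * q = 0 -> root B r.
Proof.
move=> q0 qr; have [m [q1]] := multiplicity_XsubC q r.
rewrite q0 /= => q1r defq; case: m defq => [|m] defq.
  by move: qr; rewrite defq mulr1 (negPf q1r).
rewrite defq derivM deriv_exp derivXsubC mul1r /= => E.
have {E} : ('X - r%:P) ^+ m *
    (B * (q1^`() * ('X - r%:P) + q1 *+ m.+1) + A * q1 * ('X - r%:P)) = 0.
  rewrite -[RHS]E exprSr -(mulr_natr q1) -(mulr_natr (_ ^+ m)).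
  by move: (m.+1%:R) ('X - r%:P) (q1^`()) => a c e; move: (c ^+ m) => b; ring.
move/eqP; rewrite mulf_eq0 expf_eq0 polyXsubC_eq0 andbF /= => /eqP E.
have := congr1 (horner^~ r) E.
rewrite !hornerE subrr !mulr0 add0r addr0 hornerMn => /eqP.
by rewrite mulf_eq0 mulrn_eq0 /= => /orP[//|]; rewrite -/(root _ _) (negPf q1r).
Qed.

(** A dependency gives a [B] of degree at most 2 vanishing at three points, so [B = 0] and then
    [A = 0]. The bound on [D] ensures that no coefficient is cut off. *)
Lemma row_free_log_mx (F : numFieldType) (q : {poly F}) (s : seq F) D :
  ((size q).+2 <= D)%N -> q != 0 -> size s = 3 -> uniq s -> all (root q) s ->
  row_free (log_mx q D).
Proof.
move=> leD q0 s3 us /allP rs; apply: inj_row_free => v vM.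
pose B := \poly_(i < 3) v 0 (inord i); pose A := \poly_(i < 2) v 0 (inord (i + 3)).
have sB : (size B <= 3)%N by apply: size_poly.
have sA : (size A <= 2)%N by apply: size_poly.
have defv (k : 'I_5) : v 0 k = if (k < 3)%N then B`_k else A`_(k - 3).
  rewrite !coef_poly; case: ltnP => k3; first by rewrite inord_val.
  rewrite subnK // inord_val; case: ltnP => //.
  by have := ltn_ord k; lia.
have E : B * q^`() + A * q = 0.
  have := mul_log_mx q D sB sA defv; rewrite vM => /esym E.
  apply/polyP => i; rewrite coef0; have [iD|Di] := ltnP i D.
    by move/rowP/(_ (Ordinal iD)): E; rewrite !mxE.
  rewrite nth_default //; apply: leq_trans Di; apply: leq_trans leD.
  apply: leq_trans (size_polyD _ _) _; rewrite geq_max.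
  have := size_polyMleq B q^`(); have := size_polyMleq A q.
  have := lt_size_deriv q0; move: sA sB.
  move: (size (B * _)) (size (A * _)) (size B) (size A) (size q) (size q^`()).
  by move=> a b c e f g; lia.
have B0 : B = 0.
  apply/eqP/negPn/negP => B0.
  have : (size s < size B)%N.
    apply: max_poly_roots => //; apply/allP => r /rs rq.
    exact: log_derivative_root rq E.
  by rewrite s3 ltnNge sB.
have A0 : A = 0.
  by move/eqP: E; rewrite B0 mul0r add0r mulf_eq0 (negPf q0) orbF => /eqP.
by apply/rowP => k; rewrite defv B0 A0 !coef0 if_same mxE.
Qed.

Lemma log_mx_distinct_roots (F : closedFieldType) (q : {poly F}) D :
  row_free (log_mx q D) ->
  q != 0 /\ exists s : seq F, [/\ size s = 3, uniq s & all (root q) s].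
Proof.
move=> freeM.
have q0 : q != 0.
  apply: contraTneq freeM => ->; rewrite /row_free.
  suff -> : log_mx (0 : {poly F}) D = 0 by rewrite mxrank0.
  by apply/matrixP => i j; rewrite !mxE /log_rows deriv0 !mulr0 if_same coef0.
split=> //; have [//|[B [A [B0 sB sA E]]]] := distinct_roots_log_derivative q0.
have sNA : (size (- A) <= 2)%N by rewrite size_polyN.
pose v := \row_(k < 5) if (k < 3)%N then B`_k else (- A)`_(k - 3).
have /eqP : v *m log_mx q D = 0.
  rewrite (@mul_log_mx _ q B (- A)) // => [|k]; last by rewrite mxE.
  by rewrite E mulNr subrr linear0.
rewrite mulmx_free_eq0 // => /eqP/rowP v0; case/eqP: B0.
apply/polyP => k; rewrite coef0; have [k3|] := ltnP k 3; last first.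
  by move=> k3; rewrite nth_default // (leq_trans sB).
have k5 : (k < 5)%N by apply: leq_trans k3 _.
by have := v0 (Ordinal k5); rewrite !mxE /= k3.
Qed.

(* The outer variable of [P] is the unknown, the inner one the parameter. *)
Lemma three_roots_perturbation (F : numClosedFieldType) (P : {poly {poly F}})
    (s : seq F) :
  let q e := map_poly (horner_eval e) P in
  q 0 != 0 -> size s = 3 -> uniq s -> all (root (q 0)) s ->
  exists e, [/\ e != 0, q e != 0 &
    exists t : seq F, [/\ size t = 3, uniq t & all (root (q e)) t]].
Proof.
move=> q q0 s3 us rs; pose D := (size (q 0)).+2.
have /row_freeP[N MN] := row_free_log_mx (leqnn D) q0 s3 us rs.
have mapM e : map_mx (horner_eval e) (log_mx P D) = log_mx (q e) D.
  apply/matrixP => k i; rewrite !mxE /log_rows /q deriv_map; case: ifP => _.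
    by rewrite -(map_polyXn (horner_eval e)) -rmorphM coef_map.
  by rewrite -(map_polyXn (horner_eval e)) -rmorphM coef_map.
(* [N] is a right inverse at parameter 0, so [dt] is a polynomial in the parameter with value 1 at
   0. The matrix stays row free wherever [dt] is nonzero, and the factor ['X] excludes the parameter
   0. *)
pose dt := \det (log_mx P D *m map_mx polyC N).
have dtE e : dt.[e] = \det (log_mx (q e) D *m N).
  rewrite -/(horner_eval e dt) -det_map_mx map_mxM mapM; congr (\det (_ *m _)).
  by apply/matrixP => i j; rewrite !mxE; apply: hornerC.
have dt0 : dt * 'X != 0.
  rewrite mulf_neq0 ?polyX_eq0 //; apply: contraTneq (oner_neq0 F) => dt0.
  by have := dtE 0; rewrite MN det1 dt0 horner0 => <-; rewrite eqxx.
have /closed_nonrootP[e] := dt0.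
rewrite rootE hornerM hornerX mulf_eq0 negb_or dtE => /andP[dte e0].
exists e; have /log_mx_distinct_roots[] : row_free (log_mx (q e) D); last by split.
have U : log_mx (q e) D *m N \in unitmx by rewrite unitmxE unitfE.
by apply/row_freeP; exists (N *m invmx (log_mx (q e) D *m N)); rewrite mulmxA mulmxV.
Qed.

(** * Edge vectors and the variety L *)

(** Edges are stored in increasing order only; this symmetric extension, zero on the diagonal, makes
    an edge vector usable as a matrix indexed by vertices. *)
Definition edge_val (R : realType) n (y : cvec R n) (i j : 'I_n) : R[i] :=
  if insub (i, j) is Some e then y e
  else if insub (j, i) is Some e then y e else 0.

Lemma edge_valE (R : realType) n (y : cvec R n) (e : edge n) :
  edge_val y (val e).1 (val e).2 = y e.
Proof. by rewrite /edge_val -surjective_pairing valK. Qed.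

Lemma edge_valC (R : realType) n (y : cvec R n) i j :
  edge_val y i j = edge_val y j i.
Proof.
rewrite /edge_val; case: insubP => [e1 /= ij _|_]; case: insubP => //= e2 ji _.
by have := ltn_trans ij ji; rewrite ltnn.
Qed.

Lemma edge_val_diag (R : realType) n (y : cvec R n) i : edge_val y i i = 0.
Proof. by rewrite /edge_val insubN //= ltnn. Qed.

Lemma edge_ind n (Q : 'I_n -> 'I_n -> Prop) :
  (forall i j, Q i j -> Q j i) ->
  (forall e : edge n, Q (val e).1 (val e).2) -> forall i j, i != j -> Q i j.
Proof.
move=> symQ edgeQ i j; have [ij|ji|/val_inj->] := ltngtP i j; last by rewrite eqxx.
  by move=> _; apply: (edgeQ (Sub (i, j) ij)).
by move=> _; apply: symQ; apply: (edgeQ (Sub (j, i) ji)).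
Qed.

Lemma edge_val_inj (R : realType) n (y z : cvec R n) :
  (forall i j, i != j -> edge_val y i j = edge_val z i j) -> y = z.
Proof.
move=> yz; apply: funext => e; rewrite -!edge_valE; apply: yz.
by case: e => -[i j] /= ij; rewrite neq_ltn ij.
Qed.

Definition edge_vec (R : realType) n (g : 'I_n -> 'I_n -> R[i]) : cvec R n :=
  fun e => g (val e).1 (val e).2.

Lemma edge_vecE (R : realType) n (g : 'I_n -> 'I_n -> R[i]) i j :
  (forall i j, g i j = g j i) -> i != j -> edge_val (edge_vec g) i j = g i j.
Proof.
move=> symg; move: i j; apply: edge_ind => [i j|e]; last by rewrite edge_valE.
by rewrite edge_valC symg.
Qed.

Lemma edge_val_axpy (R : realType) n (v u : cvec R n) s i j :
  edge_val (fun e => v e + s * u e) i j = edge_val v i j + s * edge_val u i j.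
Proof.
have [<-|] := eqVneq i j; first by rewrite !edge_val_diag mulr0 addr0.
move: i j; apply: edge_ind => [i j|e]; last by rewrite !edge_valE.
by rewrite ![edge_val _ i j]edge_valC.
Qed.

(** For [n = d + 2] this Cayley-Menger condition is equivalent to membership in [Lset d], by
    [Lset_flat] and [flat_Lset]. *)
Definition flat (R : realType) n (y : cvec R n) : Prop :=
  degenerate (fun i j => edge_val y i j ^+ 2) (fun=> 1).

(** The [d + 2] points in dimension [d] have an affine dependency [w]. Expanding the squared
    distances, the term in [p i] alone and the cross term are killed by [w], and what remains does
    not depend on [i]. *)
Lemma Lset_flat (R : realType) d (y : cvec R (d + 2)) : Lset d y -> flat y.
Proof.
case=> p defp.
have yp i j : edge_val y i j ^+ 2 = \sum_k (p i k - p j k) ^+ 2.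
  have [<-|] := eqVneq i j.
    rewrite edge_val_diag expr0n big1 // => k _.
    by rewrite subrr expr0n.
  move: i j; apply: edge_ind => [i j|e]; last first.
    by rewrite edge_valE; have := congr1 (@^~ e) defp.
  by rewrite edge_valC => ->; apply: eq_bigr => k _; rewrite -sqrrN opprB.
pose M : 'M[R[i]]_(d + 2, d + 1) := row_mx (\matrix_(i, k) p i k) (const_mx 1).
have /rowV0Pn[w /sub_kermxP wM w0] : kermx M != 0.
  rewrite kermx_eq0 /row_free; apply/eqP => rk.
  by have := rank_leq_col M; rewrite rk; lia.
move: wM; rewrite mul_mx_row => wM.
have sw : \sum_i w 0 i = 0.
  move/(congr1 rsubmx): wM; rewrite row_mxKr linear0.
  move/matrixP/(_ 0 0); rewrite !mxE => wM; rewrite -[RHS]wM.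
  by apply: eq_bigr => i _; rewrite mxE mulr1.
have swp k : \sum_i w 0 i * p i k = 0.
  move/(congr1 lsubmx): wM; rewrite row_mxKl linear0.
  move/matrixP/(_ 0 k); rewrite !mxE => wM; rewrite -[RHS]wM.
  by apply: eq_bigr => i _; rewrite mxE.
exists (w 0); first by move/rV0Pn: w0.
split; first by rewrite -[RHS]sw; apply: eq_bigr => i _; rewrite mul1r.
exists (\sum_j \sum_k p j k ^+ 2 * w 0 j) => i; rewrite mulr1.
transitivity (\sum_j ((\sum_k p i k ^+ 2) * w 0 j +
    (\sum_k (- 2 * p i k) * (w 0 j * p j k) + \sum_k p j k ^+ 2 * w 0 j))).
  apply: eq_bigr => j _; rewrite yp !mulr_suml -!big_split /=.
  by apply: eq_bigr => k _; ring.
rewrite !big_split /= -mulr_sumr sw mulr0 add0r exchange_big /=.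
rewrite [X in X + _]big1 ?add0r // => k _.
by rewrite -mulr_sumr swp mulr0.
Qed.

Lemma flat_Lset (R : realType) d (y : cvec R (d + 2)) : flat y -> Lset d y.
Proof.
case=> w [k0 wk0] [hw [t Xw]].
have sw : \sum_i w i = 0.
  by rewrite -[RHS]hw; apply: eq_bigr => i _; rewrite mul1r.
pose x i j := edge_val y i j ^+ 2.
have xC i j : x i j = x j i by rewrite /x edge_valC.
have x0 i : x i i = 0 by rewrite /x edge_val_diag expr0n.
have o : 'I_(d + 2) by rewrite addnC; apply: ord0.
(* The Gram matrix that points with these squared distances would have if [o] were placed at the
   origin. Its kernel contains the basis vector at [o] and [w], hence its rank is at most [d]. *)
pose G : 'M[R[i]]_(d + 2) := \matrix_(i, j) ((x o i + x o j - x i j) / 2).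
have symG : G^T = G.
  by apply/matrixP => i j; rewrite !mxE (xC j i) [x o j + _]addrC.
pose K : 'M[R[i]]_(1 + 1, d + 2) := col_mx (delta_mx 0 o) (\row_i w i).
have KG : (K <= kermx G)%MS.
  apply/sub_kermxP; rewrite mul_col_mx -[RHS]col_mx0; congr col_mx.
    rewrite -rowE; apply/rowP => j.
    by rewrite !mxE x0 add0r subrr mul0r.
  apply/rowP => j; rewrite !mxE.
  transitivity (\sum_i (x o i * w i + x o j * w i - x j i * w i) / 2).
    by apply: eq_bigr => i _; rewrite !mxE (xC i j); field.
  rewrite -mulr_suml sumrB big_split /= -mulr_sumr sw mulr0 addr0.
  by rewrite !Xw subrr mul0r.
have rkK : \rank K = 2%N.
  apply/eqP; apply: inj_row_free => v.
  rewrite -[v]hsubmxK mul_row_col => /rowP E.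
  (* Summing coordinates separates the two rows of [K]: the basis vector has sum 1 and [w] has sum
     0. *)
  have sE : \sum_i ((lsubmx v *m delta_mx 0 o : 'rV_(d + 2)) 0 i) + \sum_i ((rsubmx v *m \row_i w i) 0 i) = 0.
    by rewrite -big_split big1 // => i _; have := E i; rewrite !mxE.
  have l0 : lsubmx v = 0.
    apply/matrixP => i j; rewrite !ord1 [RHS]mxE -[RHS]sE.
    rewrite (mx11_scalar (lsubmx v)) (mx11_scalar (rsubmx v)) !mul_scalar_mx.
    rewrite (bigD1 o) //= big1 => [|i' i'o]; last first.
      by rewrite !mxE eqxx (negPf i'o) mulr0.
    under [X in _ + X]eq_bigr do rewrite !mxE.
    by rewrite -mulr_sumr sw mulr0 !addr0 !mxE !eqxx mulr1.
  have r0 : rsubmx v = 0.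
    apply/matrixP => i j; rewrite !ord1 [RHS]mxE.
    have := E k0; rewrite l0 mul0mx add0r (mx11_scalar (rsubmx v)).
    rewrite mul_scalar_mx [LHS]mxE [X in _ * X]mxE [RHS]mxE => /eqP.
    by rewrite mulf_eq0 (negPf wk0) orbF => /eqP->; rewrite !mxE eqxx.
  by rewrite l0 r0 row_mx0.
have rkG : (\rank G <= d)%N.
  have := mxrankS KG; rewrite rkK mxrank_ker; have := rank_leq_row G.
  by move: (\rank G) => r; lia.
have [P defG] := symmetric_mx_factor symG rkG.
exists (fun i k => P i k); apply: funext => e.
rewrite /sq /mmap; set i := (val e).1; set j := (val e).2.
have PG a b : \sum_k P a k * P b k = (x o a + x o b - x a b) / 2.
  move/matrixP/(_ a b): defG; rewrite !mxE => ->.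
  by apply: eq_bigr => k _; rewrite mxE.
transitivity (x i j); first by rewrite /x edge_valE.
transitivity (\sum_k P i k * P i k + \sum_k P j k * P j k - 2 * \sum_k P i k * P j k).
  by rewrite !PG !x0; field.
rewrite mulr_sumr -big_split -sumrB /=; apply: eq_bigr => k _; ring.
Qed.

(** * Directions with few roots *)

Definition line (R : realType) n (v u : cvec R n) (s : R[i]) : cvec R n :=
  fun e => v e + s * u e.

(** The special directions. Only lines and [flat] occur, so the notion is carried along by any
    linear bijection that respects [flat]. *)
Definition few_roots (R : realType) n (u : cvec R n) : Prop :=
  forall (v : cvec R n) (t : seq R[i]) (s : R[i]),
    size t = 3 -> uniq t -> (forall r, r \in t -> flat (line v u r)) ->
    flat (line v u s).

(** Every term of the Leibniz expansion collects each weight once from the rows and once from the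
    columns. *)
Lemma size_det_leq (F : comNzRingType) m (M : 'M[{poly F}]_m) (a : 'I_m -> nat) :
  (forall i j, size (M i j) <= (a i + a j).+1)%N ->
  (size (\det M) <= (2 * \sum_i a i).+1)%N.
Proof.
move=> sM; apply: leq_trans (size_sum _ _ _) _; apply/bigmax_leqP => s _.
have -> : size ((-1) ^+ s * \prod_i M i (s i)) = size (\prod_i M i (s i)).
  by rewrite mulr_sign; case: ifP => // _; rewrite size_polyN.
apply: leq_trans (size_poly_prod_leq _ _) _.
rewrite leq_subLR cardT size_enum_ord addnS ltnS.
apply: (@leq_trans (\sum_(i < m) (a i + a (s i)).+1)).
  by apply: leq_sum => i _; apply: sM.
rewrite (eq_bigr (fun i => a i + a (s i) + 1)%N) => [|i _]; last by rewrite addn1.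
rewrite !big_split /= sum1_card card_ord.
have <- : (\sum_i a i = \sum_i a (s i))%N by rewrite (reindex_inj (@perm_inj _ s)).
by rewrite mul2n -addnn addnC.
Qed.

Lemma horner_det_bordered (F : comNzRingType) n (X : 'I_n -> 'I_n -> {poly F})
    (h : 'I_n -> {poly F}) (s : F) :
  (\det (bordered X h)).[s] =
  \det (bordered (fun i j => (X i j).[s]) (fun i => (h i).[s])).
Proof. by rewrite -/(horner_eval s _) -det_map_mx map_bordered. Qed.

(* Subtracting [s ^+ 2] from row and column [c] leaves a bordered matrix whose
   determinant has degree at most 2 in [s]. *)
Lemma star_few_roots (R : realType) n (u : cvec R n) (c : 'I_n) :
  (forall i j, edge_val u i j ^+ 2 = ((i == c) (+) (j == c))%:R) -> few_roots u.
Proof.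
move=> sqru v t s t3 ut flat_t.
pose X i j : {poly R[i]} := (edge_val v i j ^+ 2)%:P +
  (2 * edge_val v i j * edge_val u i j) *: 'X -
  (2 * ((i == c) && (j == c))%:R) *: 'X^2.
pose q := \det (bordered X (fun=> 1)).
pose g r i : R[i] := - ((i == c)%:R * r ^+ 2).
have XE r i j : (X i j).[r] = edge_val (line v u r) i j ^+ 2 + g r i + g r j.
  rewrite edge_val_axpy /X !hornerE /g.
  have -> : (edge_val v i j + r * edge_val u i j) ^+ 2 = edge_val v i j ^+ 2 +
    2 * edge_val v i j * edge_val u i j * r + edge_val u i j ^+ 2 * r ^+ 2 by ring.
  by rewrite sqru; case: (i == c); case: (j == c) => /=; ring.
have nz1 : exists i : 'I_n, (1 : R[i]) != 0 by exists c; apply: oner_neq0.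
have qE r : q.[r] = 0 <-> flat (line v u r).
  rewrite horner_det_bordered; split.
    move=> /(degenerate_det _ (h := fun=> 1.[r]))E.
    have {}E : degenerate (fun i j => (X i j).[r]) (fun=> 1).
      by apply: (eq_degenerate _ _ (E _)) => // [i|]; rewrite hornerC //.
    have := degenerate_shift (fun i => - g r i) E.
    by apply: eq_degenerate => // i j; rewrite XE; ring.
  move/(degenerate_shift (g r)) => E; apply/degenerate_det.
    by case: nz1 => i i1; exists i; rewrite hornerC.
  by apply: eq_degenerate E => [i j|i]; rewrite ?XE ?hornerC.
apply/qE; suff -> : q = 0 by rewrite horner0.
apply/eqP/negPn/negP => q0.
have : (size t < size q)%N.
  by apply: max_poly_roots => //; apply/allP => r /flat_t/qE/eqP.
(* Weight 1 at [c] and 0 elsewhere, border included: after the shift the entries are linear in row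
   and column [c], quadratic at [(c, c)] and constant otherwise. *)
pose a (k : 'I_(1 + n)) : nat := if split k is inr i then (i == c) : nat else 0.
have sa : (\sum_k a k = 1)%N.
  rewrite big_split_ord /= big_ord1 /a (unsplitK (inl _)) add0n.
  under eq_bigr do rewrite (unsplitK (inr _)).
  by rewrite (bigD1 c) //= eqxx big1 // => i /negPf->.
suff : (size q <= 3)%N by rewrite t3 leqNgt => /negPf->.
have /= := @size_det_leq _ _ (bordered X (fun=> 1)) a _; rewrite sa; apply.
move=> i j; rewrite /bordered /a mxE; case: (split i) => i'; rewrite mxE.
  by case: (split j) => j'; rewrite mxE ?size_poly0 ?size_poly1.
case: (split j) => j'; rewrite mxE ?size_poly1 //.
rewrite /X; have [->|i'c] := eqVneq i' c; have [->|j'c] := eqVneq j' c.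
- rewrite edge_val_diag mulr0 mul0r scale0r expr0n addr0 add0r size_polyN.
  by rewrite (leq_trans (size_scale_leq _ _)) // size_polyXn.
- rewrite mulr0 scale0r subr0 (leq_trans (size_polyD _ _)) // geq_max.
  by rewrite (leq_trans (size_polyC_leq1 _)) //= (leq_trans (size_scale_leq _ _)) // size_polyX.
- rewrite mulr0 scale0r subr0 (leq_trans (size_polyD _ _)) // geq_max.
  by rewrite (leq_trans (size_polyC_leq1 _)) //= (leq_trans (size_scale_leq _ _)) // size_polyX.
have /eqP := sqru i' j'; rewrite (negPf i'c) (negPf j'c) /= sqrf_eq0 => /eqP->.
by rewrite !mulr0 !scale0r subr0 addr0 size_polyC_leq1.
Qed.

(** * Heron's product and lines of triangles *)

Definition heron (F : comPzRingType) (z1 z2 z3 : F) : F :=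
  (z3 ^+ 2 - z1 ^+ 2 - z2 ^+ 2) ^+ 2 - 4 * z1 ^+ 2 * z2 ^+ 2.

(** [heron] is minus sixteen times the squared area of a triangle with these side lengths. Along a
    line of triangles each of its factors is affine in the parameter. *)
Lemma heronE (F : comPzRingType) (z1 z2 z3 : F) :
  heron z1 z2 z3 = (z3 + z1 + z2) * (z3 + z1 - z2) * (z3 - z1 + z2) * (z3 - z1 - z2).
Proof. by rewrite /heron; ring. Qed.

(** Three factors have nonzero slope along the line, and the three coordinates of the base point
    allow their roots to be prescribed independently. *)
Lemma heron_line_aux (F : numClosedFieldType) (u1 u2 u3 : F) :
  u3 + u1 + u2 != 0 -> u3 + u1 - u2 != 0 -> u3 - u1 + u2 != 0 ->
  exists v1 v2 v3 s (t : seq F),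
    [/\ size t = 3, uniq t,
        forall r, r \in t -> heron (v1 + r * u1) (v2 + r * u2) (v3 + r * u3) = 0 &
        heron (v1 + s * u1) (v2 + s * u2) (v3 + s * u3) != 0].
Proof.
set m1 := u3 + u1 + u2; set m2 := u3 + u1 - u2; set m3 := u3 - u1 + u2.
move=> m10 m20 m30.
(* The last condition keeps the fourth factor from vanishing identically. If 2 violates it, then 3
   satisfies it because [m3] is nonzero. *)
have [k [k0 k1 kN]] : exists k : F, [/\ k != 0, k != 1 & m2 + k * m3 != 0].
  have [E|] := eqVneq (m2 + 2 * m3) 0; last first.
    by exists 2; split=> //; rewrite ?pnatr_eq0 // (eqr_nat F 2 1).
  exists 3; split; rewrite ?pnatr_eq0 ?(eqr_nat F 3 1) //.
  by rewrite (_ : _ + _ = m2 + 2 * m3 + m3); [rewrite E add0r | ring].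
(* The roots of the first three factors are placed at 0, 1 and k. *)
pose v1 := k * m3 / 2; pose v2 := m2 / 2; pose v3 := - (m2 + k * m3) / 2.
pose l1 := (m1%:P * 'X : {poly F}).
pose l2 := (m2%:P * ('X - 1%:P) : {poly F}).
pose l3 := (m3%:P * ('X - k%:P) : {poly F}).
pose l4 := ((u3 - u1 - u2)%:P * 'X - (m2 + k * m3)%:P : {poly F}).
have E s : heron (v1 + s * u1) (v2 + s * u2) (v3 + s * u3) = (l1 * l2 * l3 * l4).[s].
  rewrite heronE !hornerM; congr (_ * _ * _ * _);
  by rewrite ?(hornerD, hornerN, hornerM, hornerC, hornerX) /v1 /v2 /v3 /m1 /m2 /m3; field.
have l40 : l4 != 0.
  apply: contraNneq kN => /(congr1 (horner^~ 0)).
  by rewrite !hornerE /= => /eqP; rewrite oppr_eq0.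
have nz : l1 * l2 * l3 * l4 != 0.
  by rewrite !mulf_neq0 ?polyC_eq0 ?polyX_eq0 ?polyXsubC_eq0.
have /closed_nonrootP[s Ns] := nz.
have z1 : l1.[0] = 0 by rewrite hornerM hornerX mulr0.
have z2 : l2.[1] = 0 by rewrite hornerM hornerXsubC subrr mulr0.
have z3 : l3.[k] = 0 by rewrite hornerM hornerXsubC subrr mulr0.
exists v1, v2, v3, s, [:: 0; 1; k]; split=> //; last by rewrite E.
  by rewrite /= !inE !(eq_sym 0) oner_eq0 (negPf k0) (eq_sym 1) (negPf k1).
have E' r : (l1 * l2 * l3 * l4).[r] = l1.[r] * l2.[r] * l3.[r] * l4.[r].
  by rewrite 3!hornerM.
move=> r; rewrite E E' !inE => /or3P[] /eqP->.
- by rewrite z1 !mul0r.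
- by rewrite z2 mulr0 !mul0r.
- by rewrite z3 mulr0 mul0r.
Qed.

(** If at most one slope vanishes, changing the signs of [u1] and [u2] permutes the factors and
    makes it the fourth one. Two vanishing slopes force one coordinate to be 0 and the other two to
    have equal squares. *)
Lemma heron_line (F : numClosedFieldType) (u1 u2 u3 : F) :
  [\/ u1 = 0 /\ u2 ^+ 2 = u3 ^+ 2, u2 = 0 /\ u1 ^+ 2 = u3 ^+ 2 |
      u3 = 0 /\ u1 ^+ 2 = u2 ^+ 2] \/
  exists v1 v2 v3 s (t : seq F),
    [/\ size t = 3, uniq t,
        forall r, r \in t -> heron (v1 + r * u1) (v2 + r * u2) (v3 + r * u3) = 0 &
        heron (v1 + s * u1) (v2 + s * u2) (v3 + s * u3) != 0].
Proof.
have sgn (e1 e2 : F) : e1 ^+ 2 = 1 -> e2 ^+ 2 = 1 ->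
    u3 + e1 * u1 + e2 * u2 != 0 -> u3 + e1 * u1 - e2 * u2 != 0 ->
    u3 - e1 * u1 + e2 * u2 != 0 ->
    exists v1 v2 v3 s (t : seq F),
    [/\ size t = 3, uniq t,
        forall r, r \in t -> heron (v1 + r * u1) (v2 + r * u2) (v3 + r * u3) = 0 &
        heron (v1 + s * u1) (v2 + s * u2) (v3 + s * u3) != 0].
  move=> e11 e21 m1 m2 m3.
  have [v1 [v2 [v3 [s [t [t3 ut Et Es]]]]]] := heron_line_aux m1 m2 m3.
  have sE r : heron (e1 * v1 + r * u1) (e2 * v2 + r * u2) (v3 + r * u3) =
      heron (v1 + r * (e1 * u1)) (v2 + r * (e2 * u2)) (v3 + r * u3).
    rewrite /heron.
    have -> : e1 * v1 + r * u1 = e1 * (v1 + r * (e1 * u1)).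
      by rewrite mulrDr; congr (_ + _); rewrite mulrCA [e1 * (_ * _)]mulrA -expr2 e11 mul1r.
    have -> : e2 * v2 + r * u2 = e2 * (v2 + r * (e2 * u2)).
      by rewrite mulrDr; congr (_ + _); rewrite mulrCA [e2 * (_ * _)]mulrA -expr2 e21 mul1r.
    by rewrite !exprMn e11 e21 !mul1r.
  by exists (e1 * v1), (e2 * v2), v3, s, t; split=> // [r /Et|]; rewrite sE.
have half (x : F) : x + x = 0 -> x = 0.
  by move/eqP; rewrite -mulr2n mulrn_eq0 /= => /eqP.
have two x y z : x = 0 -> y = 0 -> x + y = z + z -> z = 0 :> F.
  by move=> -> -> /esym; rewrite addr0 => /half.
have twoB x y z : x = 0 -> y = 0 -> x - y = z + z -> z = 0 :> F.
  by move=> -> -> /esym; rewrite subrr => /half.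
have s1 : (1 : F) ^+ 2 = 1 by rewrite expr1n.
have sN1 : (- 1 : F) ^+ 2 = 1 by rewrite sqrrN expr1n.
have [E1|m1] := eqVneq (u3 + u1 + u2) 0.
  have [E2|m2] := eqVneq (u3 + u1 - u2) 0.
    have z : u2 = 0 by apply: (twoB _ _ _ E1 E2); ring.
    left; constructor 2; split=> //.
    by move/eqP: E1; rewrite z addr0 addr_eq0 => /eqP->; rewrite sqrrN.
  have [E3|m3] := eqVneq (u3 - u1 + u2) 0.
    have z : u1 = 0 by apply: (twoB _ _ _ E1 E3); ring.
    left; constructor 1; split=> //.
    by move/eqP: E1; rewrite z addr0 addr_eq0 => /eqP->; rewrite sqrrN.
  have [E4|m4] := eqVneq (u3 - u1 - u2) 0.
    have z : u3 = 0 by apply: (two _ _ _ E1 E4); ring.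
    left; constructor 3; split=> //.
    by move/eqP: E1; rewrite z add0r addr_eq0 => /eqP->; rewrite sqrrN.
  by right; apply: (sgn _ _ sN1 sN1); rewrite !mulN1r ?opprK.
have [E2|m2] := eqVneq (u3 + u1 - u2) 0.
  have [E3|m3] := eqVneq (u3 - u1 + u2) 0.
    have z : u3 = 0 by apply: (two _ _ _ E2 E3); ring.
    left; constructor 3; split=> //.
    by move/eqP: E2; rewrite z add0r subr_eq0 => /eqP->.
  have [E4|m4] := eqVneq (u3 - u1 - u2) 0.
    have z : u1 = 0 by apply: (twoB _ _ _ E2 E4); ring.
    left; constructor 1; split=> //.
    by move/eqP: E2; rewrite z addr0 subr_eq0 => /eqP->.
  by right; apply: (sgn _ _ sN1 s1); rewrite !mulN1r ?opprK ?mul1r.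
have [E3|m3] := eqVneq (u3 - u1 + u2) 0.
  have [E4|m4] := eqVneq (u3 - u1 - u2) 0.
    have z : u2 = 0 by apply: (twoB _ _ _ E3 E4); ring.
    left; constructor 2; split=> //.
    by move/eqP: E3; rewrite z addr0 subr_eq0 => /eqP->.
  by right; apply: (sgn _ _ s1 sN1); rewrite !mulN1r ?opprK ?mul1r.
by right; apply: (sgn _ _ s1 s1); rewrite ?mul1r.
Qed.

Lemma heron_kernel (F : fieldType) (z1 z2 z3 : F) :
  heron z1 z2 z3 = 0 -> exists k1 k2 k3 t : F,
    [/\ [|| k1 != 0, k2 != 0 | k3 != 0], k1 + k2 + k3 = 0,
       z1 ^+ 2 * k2 + z2 ^+ 2 * k3 = t, z1 ^+ 2 * k1 + z3 ^+ 2 * k3 = t &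
       z2 ^+ 2 * k1 + z3 ^+ 2 * k2 = t].
Proof.
(* The three points are collinear, at positions [0], [z1] and [y]. *)
move=> H0; have [y [yz2 yz3]] : exists y, y ^+ 2 = z2 ^+ 2 /\ (z1 - y) ^+ 2 = z3 ^+ 2.
  move/eqP: H0; rewrite (_ : heron _ _ _ =
    ((z1 - z2) ^+ 2 - z3 ^+ 2) * ((z1 + z2) ^+ 2 - z3 ^+ 2)); last by rewrite /heron; ring.
  rewrite mulf_eq0 !subr_eq0 => /orP[]/eqP E; first by exists z2.
  by exists (- z2); rewrite sqrrN opprK.
(* [(z1 - y, y, - z1)] is the affine dependency of the three collinear points; if they all coincide,
   any nonzero vector of sum 0 serves. *)
have [z10|z10] := eqVneq z1 0; first have [y0|y0] := eqVneq y 0.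
- by exists 1, (- 1), 0, 0; rewrite oner_neq0; split; rewrite -?yz2 -?yz3 ?z10 ?y0 /=; ring.
- exists (z1 - y), y, (- z1), (z1 * y * (z1 - y)); rewrite y0 orbT; split=> //;
  by rewrite -?yz2 -?yz3; ring.
- exists (z1 - y), y, (- z1), (z1 * y * (z1 - y)); rewrite oppr_eq0 z10 !orbT; split=> //;
  by rewrite -?yz2 -?yz3; ring.
Qed.

(** Eliminating [k1] and [t] leaves two linear equations in [k2] and [k3] whose determinant is
    [heron] up to sign. The combinations in the proof are Cramer's rule. *)
Lemma heron_kernel0 (F : fieldType) (z1 z2 z3 k1 k2 k3 t : F) :
  heron z1 z2 z3 != 0 -> k1 + k2 + k3 = 0 ->
  z1 ^+ 2 * k2 + z2 ^+ 2 * k3 = t -> z1 ^+ 2 * k1 + z3 ^+ 2 * k3 = t ->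
  z2 ^+ 2 * k1 + z3 ^+ 2 * k2 = t -> [/\ k1 = 0, k2 = 0 & k3 = 0].
Proof.
move=> H0 /eqP; rewrite -addrA addr_eq0 => /eqP-> <-.
move=> /eqP; rewrite -subr_eq0 => /eqP E2 /eqP; rewrite -subr_eq0 => /eqP E3.
set p := z1 ^+ 2 in E2 E3; set q := z2 ^+ 2 in E2 E3; set r := z3 ^+ 2 in E2 E3.
have k20 : k2 = 0.
  apply/eqP; suff : heron z1 z2 z3 * k2 == 0 by rewrite mulf_eq0 (negPf H0).
  apply/eqP; transitivity ((r - p - q) * (q * - (k2 + k3) + r * k2 - (p * k2 + q * k3))
    + 2 * q * (p * - (k2 + k3) + r * k3 - (p * k2 + q * k3))).
    by rewrite /heron -/p -/q -/r; ring.
  by rewrite E2 E3; ring.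
have k30 : k3 = 0.
  apply/eqP; suff : heron z1 z2 z3 * k3 == 0 by rewrite mulf_eq0 (negPf H0).
  apply/eqP; transitivity (2 * p * (q * - (k2 + k3) + r * k2 - (p * k2 + q * k3))
    + (r - p - q) * (p * - (k2 + k3) + r * k3 - (p * k2 + q * k3))).
    by rewrite /heron -/p -/q -/r; ring.
  by rewrite E2 E3; ring.
by rewrite k20 k30 addr0 oppr0.
Qed.

(** * Degeneration to a triangle *)

Lemma sum_support (V : nmodType) (I : finType) (C : seq I) (f : I -> V) :
  uniq C -> (forall i, i \notin C -> f i = 0) -> \sum_i f i = \sum_(i <- C) f i.
Proof.
move=> uC f0; rewrite (bigID (mem C)) /= [X in _ + X]big1 // addr0.
by rewrite -big_uniq.
Qed.

(* The squared edge values of a configuration in which the edges inside [C] have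
   size of order [e] and those avoiding [C] are of order 1, rescaled so that the
   limit [e = 0] splits into the block of [C] and a constant block. *)
Definition core_form (F : pzRingType) n (C : seq 'I_n) (v u : 'I_n -> 'I_n -> F)
    (e s : F) (i j : 'I_n) : F :=
  if (i \in C) && (j \in C) then (v i j + s * u i j) ^+ 2
  else if (i \in C) || (j \in C) then e * (s * u i j) ^+ 2
  else if i == j then 0 else (1 + e * (s * u i j)) ^+ 2.

Definition core_border (F : pzRingType) n (C : seq 'I_n) (e : F) (i : 'I_n) : F :=
  if i \in C then 1 else e.

(** The rows and columns in [C] are scaled by [e^-1] and the border by a further factor [e]. Taking
    [e * s] as the parameter on the line keeps the block of [C] independent of [e]. *)
Lemma core_form_flat (R : realType) n (C : seq 'I_n) (v u : cvec R n) (e s : R[i]) :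
  e != 0 ->
  let w := edge_vec (fun i j => if (i \in C) && (j \in C) then e * edge_val v i j
                     else if (i \in C) || (j \in C) then 0 else 1) in
  flat (line w u (e * s)) <->
  degenerate (core_form C (edge_val v) (edge_val u) e s) (core_border C e).
Proof.
move=> e0 w; pose l i : R[i] := if i \in C then e^-1 else 1.
have l0 i : l i != 0 by rewrite /l; case: ifP; rewrite ?invr_neq0 ?oner_neq0.
have FE i j : core_form C (edge_val v) (edge_val u) e s i j =
    l i * edge_val (line w u (e * s)) i j ^+ 2 * l j.
  rewrite edge_val_axpy /core_form /l; have [<-|ij] := eqVneq i j.
    rewrite !edge_val_diag; case: (i \in C) => /=; last by ring.
    by rewrite !mulr0 !addr0 !expr0n /= mulr0 mul0r.
  rewrite edge_vecE //; last first.
    by move=> i' j'; rewrite edge_valC andbC orbC.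
  by case: (i \in C); case: (j \in C) => /=; field.
have hE i : core_border C e i = e * l i * 1.
  by rewrite /core_border /l mulr1; case: ifP; rewrite ?mulr1 ?divff.
split.
  move/(degenerate_scale e0 l0); apply: eq_degenerate => [i j|i].
    by rewrite FE.
  by rewrite hE.
have e0' : e^-1 != 0 by rewrite invr_neq0.
have l0' i : (l i)^-1 != 0 by rewrite invr_neq0.
move/(degenerate_scale e0' l0'); apply: eq_degenerate => [i j|i].
  by rewrite FE; field; rewrite !l0.
by rewrite hE; field; rewrite e0 l0.
Qed.

(** At [e = 0] the form is the triangle block plus a block off [C] with 0 on the diagonal and 1
    elsewhere, whose border is 0. That second block is invertible as soon as it has two vertices, so
    kernel vectors live on the triangle. *)
Lemma core_form0 (F : numFieldType) n (a b c : 'I_n) (v u : 'I_n -> 'I_n -> F) (s : F) :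
  (4 < n)%N -> uniq [:: a; b; c] ->
  let z i j := v i j + s * u i j in
  (forall i, z i i = 0) -> (forall i j, z i j = z j i) ->
  degenerate (core_form [:: a; b; c] v u 0 s) (core_border [:: a; b; c] 0) <->
  heron (z a b) (z a c) (z b c) = 0.
Proof.
move=> n4 uC z z0 zC; set C := [:: a; b; c].
have Xin i w : i \in C -> (forall j, j \notin C -> w j = 0) ->
    \sum_j core_form C v u 0 s i j * w j =
    z i a ^+ 2 * w a + z i b ^+ 2 * w b + z i c ^+ 2 * w c.
  move=> iC w0; rewrite (sum_support uC) => [|j /w0->]; last by rewrite mulr0.
  by rewrite !big_cons big_nil addr0 addrA /core_form iC /= !inE !eqxx !orbT.
have hw (w : 'I_n -> F) : \sum_i core_border C 0 i * w i = w a + w b + w c.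
  rewrite (sum_support uC) => [|j jC]; last by rewrite /core_border (negPf jC) mul0r.
  by rewrite !big_cons big_nil addr0 addrA /core_border /= !inE !eqxx !orbT !mul1r.
have [aC bC cC] : [/\ a \in C, b \in C & c \in C] by rewrite !inE !eqxx !orbT.
have hin i : i \in C -> core_border C (0 : F) i = 1 by rewrite /core_border => ->.
split.
  case=> w [k wk] [hw0 [t Xw]]; apply/eqP/negPn/negP => H0.
  pose B := [pred i | i \notin C].
  have XB i : B i -> \sum_j core_form C v u 0 s i j * w j = \sum_(j | B j) w j - w i.
    move=> Bi; rewrite [in RHS](bigD1 i) //= [RHS]addrAC subrr add0r.
    rewrite (bigID (fun j => B j && (j != i))) /= addrC big1 ?add0r.
      apply: eq_bigr => j /andP[Bj ji]; rewrite /core_form.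
      by rewrite (negPf Bi) (negPf Bj) /= eq_sym (negPf ji) mul0r addr0 expr1n mul1r.
    move=> j; rewrite /core_form (negPf Bi) /= negb_and !negbK => /orP[->|/eqP->].
      by rewrite !mul0r.
    by rewrite (negPf Bi) eqxx mul0r.
  have wB i : B i -> w i = \sum_(j | B j) w j.
    move=> Bi; have := Xw i; rewrite XB // /core_border (negPf Bi) mulr0 => /eqP.
    by rewrite subr_eq0 => /eqP->.
  have cardB : (1 < #|B|)%N.
    have : (#|C| + #|B| = n)%N by rewrite -[RHS]card_ord -(cardC (mem C)); congr addn; apply: eq_card.
    by move/card_uniqP: uC => ->; rewrite /=; move: (#|B|) => m; lia.
  (* Each [w i] off [C] equals the total over [B]; summing gives the total times [#|B|], and [#|B|]
     is not 1. *)
  have sB : \sum_(j | B j) w j = 0.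
    have : \sum_(j | B j) w j = (\sum_(j | B j) w j) *+ #|B|.
      by rewrite {1}(eq_bigr (fun=> \sum_(j | B j) w j)) ?sumr_const.
    case: #|B| cardB => [|[|m]] // _; set S := \sum_(j | _) _.
    by rewrite mulrS => /eqP; rewrite -subr_eq0 opprD addNKr oppr_eq0 mulrn_eq0 => /eqP.
  have w0 i : i \notin C -> w i = 0 by move=> Bi; rewrite wB.
  have Ea := Xw a; have Eb := Xw b; have Ec := Xw c.
  move: Ea Eb Ec; rewrite !Xin // !hin // !mulr1 !z0 expr0n !mul0r ?(add0r, addr0).
  rewrite (zC b a) (zC c a) (zC c b) => Ea Eb Ec.
  have [wa wb wc] := heron_kernel0 H0 (etrans (esym (hw w)) hw0) Ea Eb Ec.
  case/negP: wk; have [|/w0->//] := boolP (k \in C).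
  by rewrite !inE => /or3P[]/eqP->; rewrite ?wa ?wb ?wc.
move/heron_kernel => [k1 [k2 [k3 [t [k0 ks E1 E2 E3]]]]].
pose w i := if i == a then k1 else if i == b then k2 else if i == c then k3 else 0.
have [ab [ac bc]] : a != b /\ a != c /\ b != c.
  by move: uC => /=; rewrite !inE negb_or => /andP[/andP[-> ->] /andP[->]].
have wa : w a = k1 by rewrite /w eqxx.
have wb : w b = k2 by rewrite /w eq_sym (negPf ab) eqxx.
have wc : w c = k3 by rewrite /w eq_sym (negPf ac) eq_sym (negPf bc) eqxx.
have w0 j : j \notin C -> w j = 0.
  by rewrite !inE !negb_or /w => /and3P[/negPf-> /negPf-> /negPf->].
exists w.
  by case/or3P: k0 => ki; [exists a; rewrite wa|exists b; rewrite wb|exists c; rewrite wc].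
split; first by rewrite hw wa wb wc.
exists t => i; have [iC|iC] := boolP (i \in C); last first.
  rewrite /core_border (negPf iC) mulr0 big1 // => j _; rewrite /core_form (negPf iC) /=.
  by have [jC|/w0->] := boolP (j \in C); rewrite ?mulr0 // mul0r mul0r.
rewrite hin // mulr1 Xin // wa wb wc; move: iC; rewrite !inE => /or3P[]/eqP->.
- by rewrite z0 expr0n mul0r add0r.
- by rewrite z0 expr0n mul0r addr0 zC.
- by rewrite z0 expr0n mul0r addr0 zC (zC c b).
Qed.

(** Otherwise some line of triangles meets Heron's product in exactly the forbidden way. It is the
    limit [e = 0] of lines in the direction [u], and the three distinct roots survive for some
    nonzero [e]. *)
Lemma few_roots_triangle (R : realType) n (u : cvec R n) (a b c : 'I_n) :
  (4 < n)%N -> few_roots u -> uniq [:: a; b; c] ->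
  [\/ edge_val u a b = 0 /\ edge_val u a c ^+ 2 = edge_val u b c ^+ 2,
      edge_val u a c = 0 /\ edge_val u a b ^+ 2 = edge_val u b c ^+ 2 |
      edge_val u b c = 0 /\ edge_val u a b ^+ 2 = edge_val u a c ^+ 2].
Proof.
move=> n4 few_u uC; set C := [:: a; b; c] in uC.
have [//|[v1 [v2 [v3 [s0 [t [t3 ut Ht Hs0]]]]]]] :=
  heron_line (edge_val u a b) (edge_val u a c) (edge_val u b c).
have [ab [ac bc]] : a != b /\ a != c /\ b != c.
  by move: uC => /=; rewrite !inE negb_or => /andP[/andP[-> ->] /andP[->]].
pose v : cvec R n := edge_vec (fun i j =>
  if (i == c) || (j == c) then if (i == a) || (j == a) then v2 else v3 else v1).
have vE i j : i != j -> edge_val v i j =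
  if (i == c) || (j == c) then if (i == a) || (j == a) then v2 else v3 else v1.
  by move=> ij; rewrite edge_vecE // => i' j'; rewrite orbC [(i' == a) || _]orbC.
have vab : edge_val v a b = v1 by rewrite vE // (negPf ac) (negPf bc).
have vac : edge_val v a c = v2 by rewrite vE // !eqxx orbT.
have vbc : edge_val v b c = v3.
  by rewrite vE // !eqxx orbT eq_sym (negPf ab) eq_sym (negPf ac).
(* The inner variable is [e] and the outer one is [s]. *)
pose E : {poly {poly R[i]}} := 'X%:P.
pose X := core_form C (fun i j => (edge_val v i j)%:P%:P)
                      (fun i j => (edge_val u i j)%:P%:P) E 'X.
pose P := \det (bordered X (core_border C E)).
pose q e := map_poly (horner_eval e) P.
have qE e s : (q e).[s] = \det (bordered
    (core_form C (edge_val v) (edge_val u) e s) (core_border C e)).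
  rewrite /q -det_map_mx map_bordered horner_det_bordered; congr (\det (bordered _ _)).
    apply: funext => i; apply: funext => j; rewrite /X /core_form.
    do 3?[case: ifP => _] => /=.
    - by rewrite rmorphXn rmorphD rmorphM /= map_polyX !map_polyC !hornerE /= /horner_eval !hornerC.
    - by rewrite rmorphM rmorphXn rmorphM /= map_polyX !map_polyC !hornerE /= /horner_eval !(hornerC, hornerX).
    - by rewrite rmorph0 horner0.
    - by rewrite rmorphXn rmorphD rmorph1 rmorphM rmorphM /= map_polyX !map_polyC !hornerE /= /horner_eval !(hornerC, hornerX).
  apply: funext => i; rewrite /core_border; case: ifP => _.
    by rewrite rmorph1 hornerC.
  by rewrite /= map_polyC hornerC /= /horner_eval hornerX.
have h0 e : exists i, core_border C (e : R[i]) i != 0.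
  by exists a; rewrite /core_border inE eqxx oner_neq0.
have q0E s : (q 0).[s] = 0 <-> heron (v1 + s * edge_val u a b)
    (v2 + s * edge_val u a c) (v3 + s * edge_val u b c) = 0.
  rewrite qE -degenerate_det // core_form0 // ?vab ?vac ?vbc //.
    by move=> i; rewrite !edge_val_diag mulr0 addr0.
  by move=> i j; rewrite ![edge_val _ i j]edge_valC.
have q0 : q 0 != 0.
  by apply: contraNneq Hs0 => q0; apply/eqP/q0E; rewrite q0 horner0.
have [|e [e0 qe0 [t' [t'3 ut' rt']]]] := three_roots_perturbation q0 t3 ut.
  by apply/allP => r /Ht/q0E/eqP.
have flatE s := core_form_flat C v u s e0.
have /closed_nonrootP[s /negP[]] := qe0.
rewrite rootE qE; apply/eqP/degenerate_det => //; apply/flatE.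
apply: (few_u _ [seq e * r | r <- t']); rewrite ?size_map ?map_inj_uniq //.
  exact: mulfI.
move=> _ /mapP[r rt ->]; apply/flatE/degenerate_det => //.
by rewrite -qE; apply/eqP; exact: (allP rt').
Qed.

(** [chi] collects the vertices joined to [o] by a zero edge. A triangle with one nonzero edge has
    exactly one zero edge and two of equal square, so the value [mu] spreads from the edge [o p] to
    all edges across the cut. *)
Lemma few_roots_cut (R : realType) n (u : cvec R n) (o p : 'I_n) :
  (4 < n)%N -> few_roots u -> edge_val u o p != 0 ->
  exists chi : pred 'I_n, exists mu : R[i],
    [/\ mu != 0, chi o, ~~ chi p &
        forall i j, edge_val u i j ^+ 2 = if chi i (+) chi j then mu else 0].
Proof.
move=> n4 few_u uop; set mu := edge_val u o p ^+ 2.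
have mu0 : mu != 0 by rewrite expf_neq0.
have nz i j : edge_val u i j ^+ 2 = mu -> edge_val u i j != 0.
  by move=> E; apply: contraNneq mu0 => z; rewrite -E z expr0n.
have tri a b c := @few_roots_triangle _ _ _ a b c n4 few_u.
pose chi i := edge_val u o i == 0.
have op : o != p by apply: contraNneq uop => ->; rewrite edge_val_diag.
have chip : ~~ chi p by [].
have tri3 (a b c : 'I_n) : a != b -> a != c -> b != c -> uniq [:: a; b; c].
  by move=> ab ac bc; rewrite /= !inE negb_or ab ac bc.
have Fp k : chi k -> edge_val u p k ^+ 2 = mu.
  move=> chik; have [<-|ok] := eqVneq o k; first by rewrite edge_valC.
  have pk : p != k by apply: contraNneq chip => ->.
  have [[E _]|[_ E]|[_ E]] := tri _ _ _ (tri3 _ _ _ op ok pk).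
  - by rewrite E eqxx in uop.
  - by rewrite -E.
  - by move/eqP: chik => z; move: mu0; rewrite /mu E z expr0n eqxx.
have Fo k : ~~ chi k -> edge_val u o k ^+ 2 = mu.
  move=> chik; have [<-//|pk] := eqVneq p k.
  have ok : o != k by apply: contraNneq chik => <-; rewrite /chi edge_val_diag.
  have [[E _]|[E _]|[_ E]] := tri _ _ _ (tri3 _ _ _ op ok pk).
  - by rewrite E eqxx in uop.
  - by rewrite /chi E eqxx in chik.
  - by rewrite -E.
have mixed i j : chi i -> ~~ chi j -> edge_val u i j ^+ 2 = mu.
  move=> ci cj; have [<-|oi] := eqVneq o i; first exact: Fo.
  have ij : i != j by apply: contraNneq cj => <-.
  have oj : o != j by apply: contraNneq cj => <-; rewrite /chi edge_val_diag.
  have [[_ <-]|[E _]|[_ E]] := tri _ _ _ (tri3 _ _ _ oi oj ij); first exact: Fo.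
    by rewrite /chi E eqxx in cj.
  by case/eqP: mu0; rewrite -(Fo j cj) -E (eqP ci) expr0n.
have same k i j : i != j -> edge_val u k i ^+ 2 = mu -> edge_val u k j ^+ 2 = mu ->
    edge_val u i j = 0.
  move=> ij Ei Ej.
  have ki : k != i by apply: contraNneq (nz _ _ Ei) => ->; rewrite edge_val_diag.
  have kj : k != j by apply: contraNneq (nz _ _ Ej) => ->; rewrite edge_val_diag.
  have [[E _]|[E _]|[//]] := tri _ _ _ (tri3 _ _ _ ki kj ij).
    by move/nz: Ei; rewrite E eqxx.
  by move/nz: Ej; rewrite E eqxx.
exists chi, mu; split=> //; first by rewrite /chi edge_val_diag.
move=> i j; have [<-|ij] := eqVneq i j.
  by rewrite addbb edge_val_diag expr0n.
case: (boolP (chi i)) (boolP (chi j)) => ci [] cj /=.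
- by rewrite (same p) ?Fp // expr0n.
- exact: mixed.
- by rewrite edge_valC mixed.
- by rewrite (same o) ?Fo // expr0n.
Qed.

(** * Excluding cuts with two vertices on both sides *)

Lemma degenerate_mul (F : fieldType) n (X : 'I_n -> 'I_n -> F) (h : 'I_n -> F) c :
  degenerate X h -> degenerate (fun i j => c * X i j) h.
Proof.
case=> w nzw [hw [t Xw]]; exists w => //; split=> //; exists (c * t) => i.
by rewrite -mulrA -Xw mulr_sumr; apply: eq_bigr => j _; rewrite mulrA.
Qed.

(** The first four equations are the rows of the special vertices at [s = - 1], where the cross
    entries are 0 and 4, and the last is the hyperplane condition. [sx] and [sy] are the sums over
    the other vertices on each side; the first two conclusions serve to show that these weights
    vanish. *)
Lemma cut_system (F : numFieldType) (a0 a1 b0 b1 sx sy t : F) :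
  2 * a1 + 4 * b1 + sy - t = 0 -> 2 * a0 + 4 * b0 + sy - t = 0 ->
  2 * b1 + 4 * a1 + sx - t = 0 -> 2 * b0 + 4 * a0 + sx - t = 0 ->
  a0 + a1 + b0 + b1 + sx + sy = 0 ->
  [/\ b0 + b1 - sx - t = 0, a0 + a1 - sy - t = 0 &
      sx = 0 -> sy = 0 -> [/\ a0 = 0, a1 = 0, b0 = 0 & b1 = 0]].
Proof.
move=> E0 E1 F0 F1 S.
set e0 := (X in X = 0) in E0; set e1 := (X in X = 0) in E1.
set f0 := (X in X = 0) in F0; set f1 := (X in X = 0) in F1.
set s := (X in X = 0) in S.
have g0 : b0 + b1 - sx - t = 0.
  by transitivity ((e0 + e1) / 2 - s); [rewrite /e0 /e1 /s; field | rewrite E0 E1 S; ring].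
have h0 : a0 + a1 - sy - t = 0.
  by transitivity ((f0 + f1) / 2 - s); [rewrite /f0 /f1 /s; field | rewrite F0 F1 S; ring].
split=> // x0 y0; set g := (X in X = 0) in g0; set h := (X in X = 0) in h0.
have t0 : t = 0.
  transitivity ((s - g - h) / 2 - sx - sy); first by rewrite /g /h /s; field.
  by rewrite S g0 h0 x0 y0; ring.
split.
- transitivity ((2 * f1 - e1 - 2 * sx + sy + t) / 6); first by rewrite /f1 /e1; field.
  by rewrite F1 E1 x0 y0 t0; ring.
- transitivity ((2 * f0 - e0 - 2 * sx + sy + t) / 6); first by rewrite /f0 /e0; field.
  by rewrite F0 E0 x0 y0 t0; ring.
- transitivity ((2 * e1 - f1 - 2 * sy + sx + t) / 6); first by rewrite /f1 /e1; field.
  by rewrite F1 E1 x0 y0 t0; ring.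
- transitivity ((2 * e0 - f0 - 2 * sy + sx + t) / 6); first by rewrite /f0 /e0; field.
  by rewrite F0 E0 x0 y0 t0; ring.
Qed.

(* On each side of the cut two vertices are special; [sg] is their sign.  With
   these cross terms the special vertices split off a 2x2 block whose
   determinant vanishes at [s = 1/2] and [s = -1/2]. *)
Lemma few_roots_cut_star (R : realType) n (u : cvec R n) (chi : pred 'I_n)
    (mu : R[i]) (x0 x1 y0 y1 : 'I_n) :
  few_roots u -> mu != 0 ->
  (forall i j, edge_val u i j ^+ 2 = if chi i (+) chi j then mu else 0) ->
  chi x0 -> chi x1 -> ~~ chi y0 -> ~~ chi y1 -> x0 != x1 -> y0 != y1 -> False.
Proof.
move=> few_u mu0 sqru cx0 cx1 cy0 cy1 x01 y01.
have neq i j : chi i -> ~~ chi j -> i != j.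
  by move=> ci; apply: contraNneq => <-.
have xy00 := neq _ _ cx0 cy0; have xy01 := neq _ _ cx0 cy1.
have xy10 := neq _ _ cx1 cy0; have xy11 := neq _ _ cx1 cy1.
pose C := [:: x0; x1; y0; y1].
have uC : uniq C by rewrite /= !inE !negb_or x01 xy00 xy01 xy10 xy11 y01.
pose sg i : R[i] := if (i == x0) || (i == y0) then 1
                    else if (i == x1) || (i == y1) then - 1 else 0.
have sx0 : sg x0 = 1 by rewrite /sg eqxx.
have sy0 : sg y0 = 1 by rewrite /sg eqxx orbT.
have sx1 : sg x1 = - 1 by rewrite /sg eq_sym (negPf x01) (negPf xy10) eqxx.
have sy1 : sg y1 = - 1.
  by rewrite /sg eq_sym (negPf xy01) eq_sym (negPf y01) eqxx orbT.
have s0 i : i \notin C -> sg i = 0.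
  by rewrite !inE !negb_or /sg => /and4P[/negPf-> /negPf-> /negPf-> /negPf->].
have [Cx0 [Cx1 [Cy0 Cy1]]] : x0 \in C /\ x1 \in C /\ y0 \in C /\ y1 \in C.
  by rewrite !inE !eqxx !orbT.
pose V i j : R[i] := sg i * sg j + ((i \notin C) && (j \notin C))%:R.
pose K i j : R[i] := if (i \in C) && (j \in C) then 2
                     else if (i \in C) || (j \in C) then 0 else - 1.
have VC i j : V i j = V j i by rewrite /V mulrC andbC.
have KC i j : K i j = K j i by rewrite /K andbC orbC.
pose Y s i j : R[i] := if chi i (+) chi j then (s + V i j) ^+ 2
                       else if i == j then 0 else K i j.
(* Across the cut [u] squares to [mu], so the line squares to [mu * (s + V i j) ^+ 2]. Inside a side
   [u] is zero, and a square root prescribes the constant value [mu * K i j]. *)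
pose v : cvec R n := edge_vec (fun i j =>
  if chi i (+) chi j then edge_val u i j * V i j else sqrtC (mu * K i j)).
have vE s i j : edge_val (line v u s) i j ^+ 2 = mu * Y s i j.
  rewrite edge_val_axpy /Y; have [<-|ij] := eqVneq i j.
    by rewrite !edge_val_diag addbb !mulr0 addr0 expr0n.
  rewrite edge_vecE //; last first.
    by move=> i' j'; rewrite addbC edge_valC VC KC.
  have := sqru i j; case: ifP => _ E.
    by rewrite -E; ring.
  by move/eqP: E; rewrite sqrf_eq0 => /eqP->; rewrite mulr0 addr0 sqrtCK.
have flatE s : flat (line v u s) <-> degenerate (Y s) (fun=> 1).
  split.
    move/(degenerate_mul mu^-1); apply: eq_degenerate => // i j.
    by rewrite vE mulKf.
  by move/(degenerate_mul mu); apply: eq_degenerate => // i j; rewrite vE.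
have ker s w : (exists i, w i != 0) -> (forall i, i \notin C -> w i = 0) ->
    w x0 + w x1 + w y0 + w y1 = 0 ->
    (forall i, Y s i x0 * w x0 + Y s i x1 * w x1 + Y s i y0 * w y0 + Y s i y1 * w y1 = 0) ->
    flat (line v u s).
  move=> nzw w0 sw Yw; apply/flatE; exists w => //; split.
    rewrite (sum_support uC) => [|i /w0->]; last by rewrite mulr0.
    by rewrite !big_cons big_nil addr0 !addrA !mul1r.
  exists 0 => i; rewrite mul0r (sum_support uC) => [|j /w0->]; last by rewrite mulr0.
  by rewrite !big_cons big_nil addr0 !addrA.
have rows s (w0 w1 w2 w3 : R[i]) :
    2 * w1 + (s + 1) ^+ 2 * w2 + (s - 1) ^+ 2 * w3 = 0 ->
    2 * w0 + (s - 1) ^+ 2 * w2 + (s + 1) ^+ 2 * w3 = 0 ->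
    (s + 1) ^+ 2 * w0 + (s - 1) ^+ 2 * w1 + 2 * w3 = 0 ->
    (s - 1) ^+ 2 * w0 + (s + 1) ^+ 2 * w1 + 2 * w2 = 0 ->
    s ^+ 2 * (w0 + w1) = 0 -> s ^+ 2 * (w2 + w3) = 0 ->
    forall i, Y s i x0 * w0 + Y s i x1 * w1 + Y s i y0 * w2 + Y s i y1 * w3 = 0.
  move=> E0 E1 E2 E3 E4 E5 i; have [|iC] := boolP (i \in C).
    rewrite !inE => /or4P[]/eqP->; rewrite /Y /V /K ?Cx0 ?Cx1 ?Cy0 ?Cy1
      ?cx0 ?cx1 ?(negPf cy0) ?(negPf cy1) /= ?sx0 ?sx1 ?sy0 ?sy1 ?eqxx
      ?(negPf x01) ?(negPf y01) ?[x1 == x0]eq_sym ?[y1 == y0]eq_sym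
      ?(negPf x01) ?(negPf y01).
    - by rewrite -[RHS]E0; ring.
    - by rewrite -[RHS]E1; ring.
    - by rewrite -[RHS]E2; ring.
    - by rewrite -[RHS]E3; ring.
  have ne j : j \in C -> (i == j) = false.
    by move=> jC; apply: contraNF iC => /eqP->.
  rewrite /Y /V /K (negPf iC) Cx0 Cx1 Cy0 Cy1 cx0 cx1 (negPf cy0) (negPf cy1).
  rewrite !ne // s0 //; case: (chi i) => /=.
    by rewrite -[RHS]E5; ring.
  by rewrite -[RHS]E4; ring.
have sgC i : i \notin C -> forall z, sg i * z = 0 by move=> /s0-> z; rewrite mul0r.
pose eta i : R[i] := if chi i then 1 else - 1.
have [ex0 ex1] : eta x0 = 1 /\ eta x1 = 1 by rewrite /eta cx0 cx1.
have [ey0 ey1] : eta y0 = - 1 /\ eta y1 = - 1 by rewrite /eta (negPf cy0) (negPf cy1).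
(* The roots 1/2, -1/2 and 0 have kernel vectors supported on [C]: there they equal [sg], [sg]
   twisted by the side, and the side sign [eta] itself. *)
have f1 : flat (line v u (1 / 2)).
  apply: (ker _ sg) => //; first by exists x0; rewrite sx0 oner_neq0.
    by rewrite sx0 sx1 sy0 sy1; ring.
  by rewrite sx0 sx1 sy0 sy1; apply: rows; field.
have f2 : flat (line v u (- 1 / 2)).
  apply: (ker _ (fun i => sg i * eta i)) => [|i /sgC->//||].
  - by exists x0; rewrite sx0 ex0 mulr1 oner_neq0.
  - by rewrite sx0 sx1 sy0 sy1 ex0 ex1 ey0 ey1; ring.
  - by rewrite sx0 sx1 sy0 sy1 ex0 ex1 ey0 ey1; apply: rows; field.
have f3 : flat (line v u 0).
  apply: (ker _ (fun i => sg i * (sg i * eta i))) => [|i /sgC->//||].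
  - by exists x0; rewrite sx0 ex0 !mulr1 oner_neq0.
  - by rewrite sx0 sx1 sy0 sy1 ex0 ex1 ey0 ey1; ring.
  - by rewrite sx0 sx1 sy0 sy1 ex0 ex1 ey0 ey1; apply: rows; ring.
(* Three roots force the line to be flat at -1 too; the rest of the proof shows that the form there
   has no nonzero kernel vector. *)
have : flat (line v u (- 1)).
  have h1 : (1 / 2 : R[i]) != 0 by rewrite mulf_neq0 ?oner_neq0 ?invr_eq0 ?pnatr_eq0.
  have h2 : (- 1 / 2 : R[i]) != 0 by rewrite mulNr oppr_eq0.
  have h3 : (1 / 2 : R[i]) != - 1 / 2.
    by rewrite -subr_eq0 (_ : _ - _ = 1) ?oner_neq0 //; field.
  apply: (few_u v [:: 1 / 2; - 1 / 2; 0]) => //.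
    by rewrite /= !inE negb_or h1 h2 h3.
  by move=> r; rewrite !inE => /or3P[]/eqP->.
case/flatE => w [k wk] [hw [t Yw]].
pose BX i := (i \notin C) && chi i; pose BY i := (i \notin C) && ~~ chi i.
have split4 (f : 'I_n -> R[i]) : \sum_i f i = f x0 + f x1 + f y0 + f y1 +
    \sum_(i | BX i) f i + \sum_(i | BY i) f i.
  rewrite (bigID (mem C)) /= [X in _ + X](bigID chi) /= -addrA; congr (_ + _).
  by rewrite -big_uniq //= !big_cons big_nil addr0 !addrA.
set sx := \sum_(i | BX i) w i; set sy := \sum_(i | BY i) w i.
have ne i j : i \in C -> j \notin C -> (i == j) = false.
  by move=> iC; apply: contraNF => /eqP<-.
have rowX i : i \in C -> chi i ->
    \sum_(j | BX j) Y (- 1) i j * w j = 0 /\ \sum_(j | BY j) Y (- 1) i j * w j = sy.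
  move=> iC ci; split.
    apply: big1 => j /andP[jC cj].
    by rewrite /Y /K ci cj ne // iC (negPf jC) mul0r.
  apply: eq_bigr => j /andP[jC cj].
  by rewrite /Y /V ci (negPf cj) /= iC (s0 j) // mulr0 !addr0 sqrrN expr1n mul1r.
have rowY i : i \in C -> ~~ chi i ->
    \sum_(j | BX j) Y (- 1) i j * w j = sx /\ \sum_(j | BY j) Y (- 1) i j * w j = 0.
  move=> iC ci; split.
    apply: eq_bigr => j /andP[jC cj].
    by rewrite /Y /V (negPf ci) cj /= iC (s0 j) // mulr0 !addr0 sqrrN expr1n mul1r.
  apply: big1 => j /andP[jC cj].
  by rewrite /Y /K (negPf ci) (negPf cj) ne // iC (negPf jC) mul0r.
have inner (P : pred 'I_n) i : P i ->
    \sum_(j | P j) (if i == j then 0 else - 1) * w j = - (\sum_(j | P j) w j) + w i.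
  move=> Pi; rewrite (bigD1 i) //= [in RHS](bigD1 i) //= eqxx mul0r add0r.
  rewrite opprD addrC addrA subrr add0r -sumrN; apply: eq_bigr => j /andP[_ ji].
  by rewrite eq_sym (negPf ji) mulN1r.
have rowBX i : BX i -> w y0 + w y1 - sx + w i = t.
  move=> Bi; have /andP[iC ci] := Bi.
  have := Yw i; rewrite mulr1 split4 => <-.
  rewrite (eq_bigr (fun j => (if i == j then 0 else - 1) * w j)); last first.
    by move=> j /andP[jC cj]; rewrite /Y /K ci cj (negPf iC) (negPf jC).
  rewrite (inner BX) // [\sum_(j | BY j) _]big1; last first.
    by move=> j /andP[jC cj]; rewrite /Y /V ci (negPf cj) /= iC jC !s0 //=; ring.
  rewrite /Y /V /K cx0 cx1 ci (negPf cy0) (negPf cy1) /= (negPf iC) Cx0 Cx1 Cy0 Cy1.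
  by rewrite ![i == _]eq_sym !ne // (s0 i) //= -/sx; ring.
have rowBY i : BY i -> w x0 + w x1 - sy + w i = t.
  move=> Bi; have /andP[iC ci] := Bi.
  have := Yw i; rewrite mulr1 split4 => <-.
  rewrite [\sum_(j | BY j) _](eq_bigr (fun j => (if i == j then 0 else - 1) * w j)); last first.
    by move=> j /andP[jC cj]; rewrite /Y /K (negPf ci) (negPf cj) (negPf iC) (negPf jC).
  rewrite (inner BY) // [\sum_(j | BX j) _]big1; last first.
    by move=> j /andP[jC cj]; rewrite /Y /V (negPf ci) cj /= iC jC !s0 //=; ring.
  rewrite /Y /V /K cx0 cx1 (negPf ci) (negPf cy0) (negPf cy1) /= (negPf iC) Cx0 Cx1 Cy0 Cy1.
  by rewrite ![i == _]eq_sym !ne // (s0 i) //= -/sy; ring.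
have [] := @cut_system _ (w x0) (w x1) (w y0) (w y1) sx sy t.
- have [b1 b2] := rowX _ Cx0 cx0; have := Yw x0; rewrite mulr1 split4 b1 b2 => <-.
  rewrite /Y /V /K cx0 cx1 (negPf cy0) (negPf cy1) /= Cx0 Cx1 Cy0 Cy1 eqxx (negPf x01).
  by rewrite /= ?sx0 ?sx1 ?sy0 ?sy1; ring.
- have [b1 b2] := rowX _ Cx1 cx1; have := Yw x1; rewrite mulr1 split4 b1 b2 => <-.
  rewrite /Y /V /K cx0 cx1 (negPf cy0) (negPf cy1) /= Cx0 Cx1 Cy0 Cy1 eqxx eq_sym (negPf x01).
  by rewrite /= ?sx0 ?sx1 ?sy0 ?sy1; ring.
- have [b1 b2] := rowY _ Cy0 cy0; have := Yw y0; rewrite mulr1 split4 b1 b2 => <-.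
  rewrite /Y /V /K cx0 cx1 (negPf cy0) (negPf cy1) /= Cx0 Cx1 Cy0 Cy1 eqxx (negPf y01).
  by rewrite /= ?sx0 ?sx1 ?sy0 ?sy1; ring.
- have [b1 b2] := rowY _ Cy1 cy1; have := Yw y1; rewrite mulr1 split4 b1 b2 => <-.
  rewrite /Y /V /K cx0 cx1 (negPf cy0) (negPf cy1) /= Cx0 Cx1 Cy0 Cy1 eqxx eq_sym (negPf y01).
  by rewrite /= ?sx0 ?sx1 ?sy0 ?sy1; ring.
- by rewrite -[RHS]hw; under [RHS]eq_bigr do rewrite mul1r; rewrite split4.
(* Compared with [rowBX] and [rowBY], these relations give [w i = 0] at every vertex outside [C],
   hence [sx = sy = 0]. *)
move=> gX gY last_step.
have wX i : BX i -> w i = 0.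
  move/rowBX => E; move: gX; rewrite -E => g; apply: oppr_inj; rewrite oppr0 -[RHS]g; ring.
have wY i : BY i -> w i = 0.
  move/rowBY => E; move: gY; rewrite -E => g; apply: oppr_inj; rewrite oppr0 -[RHS]g; ring.
have sx_0 : sx = 0 by apply: big1.
have sy_0 : sy = 0 by apply: big1.
have [a0 a1 b0 b1] := last_step sx_0 sy_0.
case/negP: wk; apply/eqP; have [|kC] := boolP (k \in C).
  by rewrite !inE => /or4P[]/eqP->.
by have [ck|ck] := boolP (chi k); [apply: wX|apply: wY]; apply/andP.
Qed.

(** One side of the cut is a single vertex, [o] or [p], and that vertex is the centre. *)
Lemma few_roots_star (R : realType) n (u : cvec R n) (o p : 'I_n) :
  (4 < n)%N -> few_roots u -> edge_val u o p != 0 ->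
  exists c, exists2 mu : R[i], mu != 0 &
    forall i j, edge_val u i j ^+ 2 = if (i == c) (+) (j == c) then mu else 0.
Proof.
move=> n4 few_u uop.
have [chi [mu [mu0 co cp sqru]]] := few_roots_cut n4 few_u uop.
have [/existsP[x1 /andP[cx1 ox]]|/existsPn noX] := boolP [exists x, chi x && (o != x)].
  have [/existsP[y1 /andP[cy1 py]]|/existsPn noY] := boolP [exists y, ~~ chi y && (p != y)].
    by case: (few_roots_cut_star few_u mu0 sqru co cx1 cp cy1).
  have chiE i : chi i = ~~ (i == p).
    have [->|ip] := eqVneq i p; first exact: negbTE.
    by have := noY i; rewrite [p == _]eq_sym ip andbT negbK.
  by exists p, mu => // i j; rewrite sqru !chiE addNb addbN negbK.
have chiE i : chi i = (i == o).
  have [->|io] := eqVneq i o; first by [].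
  by apply/negbTE; have := noX i; rewrite [o == _]eq_sym io andbT.
by exists o, mu => // i j; rewrite sqru !chiE.
Qed.

(** * Linear automorphisms *)

Lemma mat_apply_line (R : realType) n (A : cmat R n) (v u : cvec R n) s :
  mat_apply A (line v u s) = line (mat_apply A v) (mat_apply A u) s.
Proof.
apply: funext => e; rewrite /mat_apply /line mulr_sumr -big_split /=.
by apply: eq_bigr => f _; ring.
Qed.

Lemma nonsingular_inverse (R : realType) n (A : cmat R n) :
  nonsingular A ->
  exists B : cmat R n, cancel (mat_apply A) (mat_apply B) /\
                       cancel (mat_apply B) (mat_apply A).
Proof.
move=> injA; pose N := #|{: edge n}|.
pose M : 'M[R[i]]_N := \matrix_(i, j) A (enum_val i) (enum_val j).
pose cv (v : cvec R n) : 'cV[R[i]]_N := \col_i v (enum_val i).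
have cvI v w : cv v = cv w -> v = w.
  move/colP=> E; apply: funext => e; have := E (enum_rank e).
  by rewrite !mxE enum_rankK.
have sumE (V : nmodType) (F : edge n -> V) : \sum_e F e = \sum_(i < N) F (enum_val i).
  by rewrite (reindex (fun i : 'I_N => enum_val i : edge n)) //=; exists enum_rank => i _; rewrite ?enum_valK ?enum_rankK.
have MA v : M *m cv v = cv (mat_apply A v).
  apply/colP => i; rewrite !mxE /mat_apply sumE.
  by apply: eq_bigr => j _; rewrite !mxE.
have uM : M \in unitmx.
  rewrite unitmxE unitfE -det_tr; apply/det0P => -[v nzv vM].
  pose w : cvec R n := fun e => v 0 (enum_rank e).
  have cvw : cv w = v^T by apply/colP => i; rewrite !mxE /w enum_valK.
  have w0 : w = fun=> 0.
    apply: injA; apply: cvI; rewrite -!MA cvw.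
    have -> : cv (fun=> 0) = 0 by apply/colP => i; rewrite !mxE.
    by rewrite mulmx0 -[M]trmxK -trmx_mul vM trmx0.
  case/negP: nzv; apply/eqP/rowP => i; rewrite mxE.
  by have := congr1 (@^~ (enum_val i)) w0; rewrite /w enum_valK.
pose B : cmat R n := fun e f => invmx M (enum_rank e) (enum_rank f).
have MB v : invmx M *m cv v = cv (mat_apply B v).
  apply/colP => i; rewrite !mxE /mat_apply sumE.
  by apply: eq_bigr => j _; rewrite !mxE /B !enum_valK.
exists B; split=> v; apply: cvI; first by rewrite -MB -MA mulKmx.
by rewrite -MA -MB mulKVmx.
Qed.

(** Carrying the inverse along makes the notion symmetric, so every result applies to [B] as well as
    to [A]. *)
Definition flat_aut (R : realType) n (A B : cmat R n) : Prop :=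
  [/\ cancel (mat_apply A) (mat_apply B), cancel (mat_apply B) (mat_apply A) &
      forall y, flat (mat_apply A y) <-> flat y].

Lemma flat_aut_sym (R : realType) n (A B : cmat R n) : flat_aut A B -> flat_aut B A.
Proof. by case=> AK BK fA; split=> // y; rewrite -fA BK. Qed.

Lemma lin_aut_flat (R : realType) d (A : cmat R (d + 2)) :
  lin_aut d A -> exists B, flat_aut A B.
Proof.
case=> injA LA AL; have [B [AK BK]] := nonsingular_inverse injA.
exists B; split=> // y; split=> [/flat_Lset/AL[z Lz /injA<-]|/flat_Lset/LA].
  exact: Lset_flat.
exact: Lset_flat.
Qed.

Lemma few_roots_aut (R : realType) n (A B : cmat R n) (u : cvec R n) :
  flat_aut A B -> few_roots u -> few_roots (mat_apply A u).
Proof.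
case=> AK BK fA few_u v t s t3 ut Ht.
rewrite -[v]BK -mat_apply_line; apply/fA; apply: (few_u _ t) => // r /Ht.
by move=> Hr; apply/fA; rewrite mat_apply_line BK.
Qed.

(** * Images of signed stars *)

Definition star_vec (R : realType) n (c : 'I_n) (b : pred 'I_n) : cvec R n :=
  edge_vec (fun i j => if i == c then (-1) ^+ b j else
                       if j == c then (-1) ^+ b i else 0).

Definition unit_vec (R : realType) n (i j : 'I_n) : cvec R n :=
  edge_vec (fun p q => (((p == i) && (q == j)) || ((p == j) && (q == i)))%:R).

Definition flip n (k : 'I_n) (b : pred 'I_n) : pred 'I_n := fun i => b i (+) (i == k).

Lemma star_vecE (R : realType) n (c : 'I_n) (b : pred 'I_n) i j : i != j ->
  edge_val (star_vec R c b) i j = if i == c then (-1) ^+ b j else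
                                  if j == c then (-1) ^+ b i else 0.
Proof.
move=> ij; rewrite edge_vecE // => p q.
by have [->|_] := eqVneq p c; have [E|_] := eqVneq q c; rewrite ?E.
Qed.

Lemma unit_vecE (R : realType) n (i j p q : 'I_n) : p != q ->
  edge_val (unit_vec R i j) p q = (((p == i) && (q == j)) || ((p == j) && (q == i)))%:R.
Proof.
move=> pq; rewrite edge_vecE // => a b.
by rewrite orbC [(a == j) && _]andbC [(a == i) && _]andbC.
Qed.

Lemma unit_vecC (R : realType) n (i j : 'I_n) : unit_vec R i j = unit_vec R j i.
Proof. by apply: funext => e; rewrite /unit_vec /edge_vec orbC. Qed.

Lemma star_vec_sqr (R : realType) n (c : 'I_n) (b : pred 'I_n) i j :
  edge_val (star_vec R c b) i j ^+ 2 = ((i == c) (+) (j == c))%:R.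
Proof.
have [<-|ij] := eqVneq i j; first by rewrite addbb edge_val_diag expr0n.
rewrite star_vecE //; have [ic|_] := eqVneq i c.
  by rewrite ic eq_sym in ij; rewrite (negPf ij) sqrr_sign.
by case: ifP => _; rewrite ?sqrr_sign ?expr0n.
Qed.

(** This difference of two stars gives access to the images of the unit edge vectors. *)
Lemma star_vec_flip (R : realType) n (c k : 'I_n) (b : pred 'I_n) : k != c ->
  star_vec R c b = line (star_vec R c (flip k b)) (unit_vec R c k) (2 * (-1) ^+ b k).
Proof.
move=> kc; apply: edge_val_inj => i j ij.
rewrite edge_val_axpy !star_vecE // unit_vecE // /flip.
have [ic|_] := eqVneq i c.
  have [jk|_] := eqVneq j k.
    by rewrite jk ic addbT /=; case: (b k) => /=; ring.
  by rewrite addbF andbF ic eq_sym (negPf kc) mulr0 addr0.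
have [jc|_] := eqVneq j c.
  have [ik|_] := eqVneq i k.
    by rewrite ik addbT /=; case: (b k) => /=; ring.
  by rewrite addbF mulr0 addr0.
by rewrite andbF mulr0 addr0.
Qed.

Lemma mat_apply_unit (R : realType) n (A : cmat R n) (e f : edge n) :
  mat_apply A (unit_vec R (val f).1 (val f).2) e = A e f.
Proof.
rewrite /mat_apply (bigD1 f) //= big1 => [|g gf].
  by rewrite /unit_vec /edge_vec !eqxx mulr1 addr0.
rewrite /unit_vec /edge_vec; case: (boolP (_ || _)); last by rewrite mulr0.
case/orP => /andP[/eqP E1 /eqP E2].
  case/eqP: gf; apply: val_inj; rewrite [val g]surjective_pairing E1 E2.
  by rewrite -surjective_pairing.
by have := valP g; have := valP f; rewrite /= E1 E2 => /ltn_trans lt /lt; rewrite ltnn.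
Qed.

Lemma three_others n (a b : 'I_n) : (4 < n)%N ->
  exists m1 m2 m3, [/\ uniq [:: m1; m2; m3], m1 \notin [:: a; b],
                       m2 \notin [:: a; b] & m3 \notin [:: a; b]].
Proof.
move=> n4; pose s := enum [pred x | x \notin [:: a; b]].
have us : uniq s by apply: enum_uniq.
have ss x : x \in s -> x \notin [:: a; b] by rewrite mem_enum.
have : (2 < size s)%N.
  rewrite -cardE; have c2 : (#|mem [:: a; b]| <= 2)%N by apply: card_size.
  have cB : #|[predC (mem [:: a; b])]| = #|[pred x | x \notin [:: a; b]]| by apply: eq_card.
  have := cardC (mem [:: a; b]); rewrite card_ord cB => E.
  rewrite -(ltn_add2l #|mem [:: a; b]|) E.
  by apply: leq_ltn_trans n4; rewrite (leq_add c2 (leqnn 2)).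
case: s us ss => [|m1 [|m2 [|m3 s]]] //= us ss _.
exists m1, m2, m3; split.
- by move: us; rewrite !inE !negb_or => /and3P[/and3P[-> -> _] /andP[-> _]].
- by apply: ss; rewrite inE eqxx.
- by apply: ss; rewrite !inE eqxx orbT.
- by apply: ss; rewrite !inE eqxx !orbT.
Qed.

Definition star_center (R : realType) n (y : cvec R n) (j : 'I_n) : Prop :=
  exists2 mu : R[i], mu != 0 &
    forall p q, edge_val y p q ^+ 2 = if (p == j) (+) (q == j) then mu else 0.

Lemma star_center_neq0 (R : realType) n (y : cvec R n) j m :
  star_center y j -> m != j -> edge_val y j m != 0.
Proof.
case=> mu mu0 E mj; rewrite -sqrf_eq0 E eqxx (negPf mj) /=; exact: mu0.
Qed.

Lemma star_center_eq0 (R : realType) n (y : cvec R n) j p q :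
  star_center y j -> p != j -> q != j -> edge_val y p q = 0.
Proof.
case=> mu mu0 E pj qj; apply/eqP.
by rewrite -sqrf_eq0 E (negPf pj) (negPf qj).
Qed.

(** The image is special, and it is nonzero because [A] is injective. *)
Lemma star_center_aut (R : realType) n (A B : cmat R n) (c : 'I_n) (b : pred 'I_n) :
  (4 < n)%N -> flat_aut A B ->
  exists j, star_center (mat_apply A (star_vec R c b)) j.
Proof.
move=> n4 autA; have few := few_roots_aut autA (star_few_roots (@star_vec_sqr R n c b)).
case: autA => AK _ _; set y := mat_apply A _ in few *.
have [/existsP[o /existsP[p nz]]|no] := boolP [exists o, exists p, edge_val y o p != 0].
  exact: few_roots_star n4 few nz.
have [m [_ [_ [_ mc _ _]]]] := three_others c c n4.
have y0 : y = mat_apply A (fun=> 0).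
  apply: edge_val_inj => i j ij.
  have -> : edge_val y i j = 0.
    by apply/eqP/negPn/negP => nz; case/existsP: no; exists i; apply/existsP; exists j.
  move: i j ij; apply: edge_ind => [i j|e]; first by rewrite edge_valC.
  by rewrite edge_valE /mat_apply big1 // => f _; rewrite mulr0.
have := congr1 (mat_apply B) y0; rewrite /y !AK => s0.
have := star_vec_sqr R c b m c; rewrite s0 eqxx.
have -> : edge_val (fun=> 0 : R[i]) m c = 0 by rewrite /edge_val; do 2?case: insubP.
rewrite expr0n (_ : m == c = false) /=; last by move: mc; rewrite !inE orbb => /negPf.
by move/esym/eqP; rewrite oner_eq0.
Qed.

Lemma aut_flip (R : realType) n (A : cmat R n) (c k : 'I_n) (b : pred 'I_n) p q :
  k != c ->
  edge_val (mat_apply A (star_vec R c b)) p q =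
  edge_val (mat_apply A (star_vec R c (flip k b))) p q +
  2 * (-1) ^+ b k * edge_val (mat_apply A (unit_vec R c k)) p q.
Proof. by move=> kc; rewrite (star_vec_flip R b kc) mat_apply_line edge_val_axpy. Qed.

(** The hypotheses confine both images to the single edge [j j']. They would then be proportional,
    whereas [A] is injective. *)
Lemma aut_unit_independent (R : realType) n (A B : cmat R n) (c k l j j' : 'I_n) :
  flat_aut A B -> k != c -> l != c -> k != l ->
  (forall p q, (p != j) || (q != j') -> (p != j') || (q != j) ->
    edge_val (mat_apply A (unit_vec R c k)) p q = 0) ->
  (forall p q, (p != j) || (q != j') -> (p != j') || (q != j) ->
    edge_val (mat_apply A (unit_vec R c l)) p q = 0) -> False.
Proof.
case=> AK _ _ kc lc kl Hk Hl.
pose ak := mat_apply A (unit_vec R c k); pose al := mat_apply A (unit_vec R c l).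
pose x := edge_val ak j j'; pose x' := edge_val al j j'.
have zero_line (v u : cvec R n) s : edge_val (mat_apply A v) j j' +
    s * edge_val (mat_apply A u) j j' = 0 ->
  (forall p q, (p != j) || (q != j') -> (p != j') || (q != j) ->
    edge_val (mat_apply A v) p q = 0) ->
  (forall p q, (p != j) || (q != j') -> (p != j') || (q != j) ->
    edge_val (mat_apply A u) p q = 0) -> forall p q, edge_val (line v u s) p q = 0.
  move=> E Hv Hu p q; rewrite -[line v u s]AK.
  have -> : mat_apply A (line v u s) = mat_apply A (fun=> 0).
    apply: edge_val_inj => i i' ii'; rewrite mat_apply_line edge_val_axpy.
    have -> : edge_val (mat_apply A (fun=> 0)) i i' = 0.
      move: i i' ii'; apply: edge_ind => [i i'|e]; first by rewrite edge_valC.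
      by rewrite edge_valE /mat_apply big1 // => f _; rewrite mulr0.
    have [/andP[/eqP-> /eqP->]//|N1] := boolP ((i == j) && (i' == j')).
    have [/andP[/eqP-> /eqP->]|N2] := boolP ((i == j') && (i' == j)).
      by rewrite ![edge_val _ j' j]edge_valC.
    by rewrite negb_and in N1; rewrite negb_and in N2; rewrite Hv // Hu // mulr0 addr0.
  by rewrite AK /edge_val; do 2?case: insubP.
have uE m m' : m != c -> edge_val (unit_vec R c m') c m = (m == m')%:R.
  move=> mc; rewrite unit_vecE 1?eq_sym // eqxx /= eq_sym.
  by case: (m == m') => //=; rewrite eq_sym (negPf mc) andbF.
have [x0|x0] := eqVneq x 0.
  have := @zero_line (unit_vec R c k) (unit_vec R c l) 0 _ Hk Hl c k.
  rewrite edge_val_axpy mul0r addr0 uE // eqxx => E.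
  by have := E x0; rewrite mul0r addr0 => /eqP; rewrite oner_eq0.
have := @zero_line (unit_vec R c l) (unit_vec R c k) (- (x' / x)) _ Hl Hk c l.
rewrite edge_val_axpy !uE // eqxx [l == k]eq_sym (negPf kl) mulr0 addr0 => E.
have /E/eqP : x' + - (x' / x) * x = 0 by rewrite mulNr divfK // subrr.
by rewrite oner_eq0.
Qed.

(* If flipping the sign at [k] moves the centre from [j] to [j'], then by
   comparing supports it exchanges the two for every sign pattern, and so does
   flipping all but at most one of the other signs.  Three such flips change a
   nonzero entry [x] at [j] into [- 2 x], although the centre is then [j']. *)
Lemma star_center_flip (R : realType) n (A B : cmat R n) (c k j j' : 'I_n)
    (b : pred 'I_n) :
  (4 < n)%N -> flat_aut A B -> k != c ->
  star_center (mat_apply A (star_vec R c b)) j ->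
  star_center (mat_apply A (star_vec R c (flip k b))) j' -> j = j'.
Proof.
move=> n4 autA kc bj bj'; apply/eqP/negPn/negP => jj'.
pose y b := mat_apply A (star_vec R c b); pose a l := mat_apply A (unit_vec R c l).
have yE l b0 p q : l != c ->
  edge_val (y b0) p q = edge_val (y (flip l b0)) p q + 2 * (-1) ^+ b0 l * edge_val (a l) p q.
  exact: aut_flip.
have ex b0 : exists i, star_center (y b0) i by apply: star_center_aut autA.
have two0 l (b0 : pred 'I_n) : 2 * (-1) ^+ b0 l != 0 :> R[i].
  by rewrite mulf_neq0 ?signr_eq0 ?pnatr_eq0.
have a_eq0 l b0 i i' p q : l != c -> star_center (y b0) i ->
    star_center (y (flip l b0)) i' -> p != i -> q != i -> p != i' -> q != i' ->
    edge_val (a l) p q = 0.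
  move=> lc bi bi' pi qi pi' qi'; have := yE l b0 p q lc.
  rewrite (star_center_eq0 bi) // (star_center_eq0 bi') // add0r => /esym/eqP.
  by rewrite mulf_eq0 (negPf (two0 _ _)) /= => /eqP.
have a_neq0 l b0 i i' m : l != c -> star_center (y b0) i ->
    star_center (y (flip l b0)) i' -> i != i' -> m != i -> m != i' ->
    edge_val (a l) i m != 0 /\ edge_val (a l) i' m != 0.
  move=> lc bi bi' ii' mi mi'; split.
    have := star_center_neq0 bi mi; rewrite (yE l) //.
    by rewrite (star_center_eq0 bi') // add0r; apply: contraNneq => ->; rewrite mulr0.
  have := star_center_neq0 bi' mi'; apply: contraNneq => z.
  have i'i : i' != i by rewrite eq_sym.
  by have := yE l b0 i' m lc; rewrite z mulr0 addr0 (star_center_eq0 bi) // => <-.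
(* The image of the unit vector at [l] is nonzero on all edges from [i] or [i'] to a third vertex,
   and these must all meet the centres [i1] or [i1']. Three such edges at one vertex cannot be
   covered by two other vertices. *)
have swap l b0 i i' : l != c -> star_center (y b0) i -> star_center (y (flip l b0)) i' ->
    i != i' -> forall b1 i1 i1', star_center (y b1) i1 -> star_center (y (flip l b1)) i1' ->
    (i1 = i /\ i1' = i') \/ (i1 = i' /\ i1' = i).
  move=> lc bi bi' ii' b1 i1 i1' b1i b1i'.
  have inn z z' : z != z' ->
    (forall m, m \notin [:: z; z'] -> edge_val (a l) z m != 0) -> z \in [:: i1; i1'].
    move=> zz' nz; have [m1 [m2 [m3 [um M1 M2 M3]]]] := three_others z z' n4.
    apply/negPn/negP; rewrite !inE negb_or => /andP[N N'].
    have H m : m \notin [:: z; z'] -> (m == i1) || (m == i1').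
      move=> Hm; apply: contraNT (nz m Hm); rewrite negb_or => /andP[P P'].
      by rewrite (a_eq0 l b1 i1 i1').
    move: um (H _ M1) (H _ M2) (H _ M3).
    rewrite /= !inE negb_or => /andP[/andP[N1 N2] /andP[N3 _]].
    move=> /orP[]/eqP E1 /orP[]/eqP E2 /orP[]/eqP E3; move: N1 N2 N3;
    by rewrite E1 E2 E3 ?eqxx.
  have I : i \in [:: i1; i1'].
    apply: (inn _ i') => // m; rewrite !inE negb_or => /andP[mi mi'].
    by case: (a_neq0 l b0 i i' m).
  have I' : i' \in [:: i1; i1'].
    apply: (inn _ i); first by rewrite eq_sym.
    move=> m; rewrite !inE negb_or => /andP[mi' mi].
    by case: (a_neq0 l b0 i i' m).
  move: I I'; rewrite !inE => /orP[]/eqP E /orP[]/eqP E'; subst => //.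
  - by rewrite eqxx in ii'.
  - by left.
  - by right.
  - by rewrite eqxx in ii'.
have swapk := swap _ _ _ _ kc bj bj' jj'.
have center b0 i : star_center (y b0) i -> i = j \/ i = j'.
  move=> bi; have [i' bi'] := ex (flip k b0).
  by have [[-> _]|[-> _]] := swapk _ _ _ bi bi'; [left|right].
(* Either the flip at [l] also exchanges [j] and [j'], or it fixes both centres. In the latter case
   the image of the unit vector lives on edges through [j] and also on edges through [j'], that is,
   on the edge [j j']. *)
have dich l : l != c ->
    (forall b1 i1 i1', star_center (y b1) i1 -> star_center (y (flip l b1)) i1' ->
       (i1 = j /\ i1' = j') \/ (i1 = j' /\ i1' = j)) \/
    (forall p q, (p != j) || (q != j') -> (p != j') || (q != j) -> edge_val (a l) p q = 0).
  move=> lc; have [i bi] := ex (flip l b); have [i' bi'] := ex (flip l (flip k b)).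
  have [ij|ij] := eqVneq j i; last first.
    left=> b1 i1 i1' h1 h2; have := swap l b j i lc bj bi ij b1 i1 i1' h1 h2.
    by have [E|->//] := center _ _ bi; rewrite E eqxx in ij.
  have [ij'|ij'] := eqVneq j' i'; last first.
    left=> b1 i1 i1' h1 h2; have := swap l _ j' i' lc bj' bi' ij' b1 i1 i1' h1 h2.
    by have [->|E] := center _ _ bi'; [case; [right|left] | rewrite E eqxx in ij'].
  right=> p q P P'; subst i i'.
  have [pj|pj] := eqVneq p j.
    rewrite pj eqxx /= in P; subst p; have [qj|qj] := eqVneq q j.
      by rewrite qj edge_val_diag.
    by apply: (a_eq0 l (flip k b) j' j').
  have [qj|qj] := eqVneq q j; last by apply: (a_eq0 l b j j).
  rewrite qj eqxx orbF in P'; subst q.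
  by apply: (a_eq0 l (flip k b) j' j').
have [l1 [l2 [l3 [ul L1 L2 L3]]]] := three_others c k n4.
(* By [aut_unit_independent] at most one of [l1], [l2], [l3] falls in the second case. *)
have [l [m [lc [mc [lk [mk [lm [Sl Sm]]]]]]]] : exists l m : 'I_n, l != c /\ m != c /\
    l != k /\ m != k /\ l != m /\
    (forall b1 i1 i1', star_center (y b1) i1 -> star_center (y (flip l b1)) i1' ->
       (i1 = j /\ i1' = j') \/ (i1 = j' /\ i1' = j)) /\
    (forall b1 i1 i1', star_center (y b1) i1 -> star_center (y (flip m b1)) i1' ->
       (i1 = j /\ i1' = j') \/ (i1 = j' /\ i1' = j)).
  move: L1 L2 L3; rewrite !inE !negb_or => /andP[c1 k1] /andP[c2 k2] /andP[c3 k3].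
  move: ul; rewrite /= !inE negb_or => /andP[/andP[n12 n13] /andP[n23 _]].
  have [S1|S1] := dich _ c1; have [S2|S2] := dich _ c2; have [S3|S3] := dich _ c3;
    try by [exists l1, l2 | exists l1, l3 | exists l2, l3].
  - by case: (aut_unit_independent autA c2 c3 n23 S2 S3).
  - by case: (aut_unit_independent autA c1 c3 n13 S1 S3).
  - by case: (aut_unit_independent autA c1 c2 n12 S1 S2).
  - by case: (aut_unit_independent autA c1 c2 n12 S1 S2).
have [p [_ [_ [_ P _ _]]]] := three_others j j' n4.
move: P; rewrite !inE negb_or => /andP[pj pj'].
have to_j' l0 b0 : (forall b1 i1 i1', star_center (y b1) i1 -> star_center (y (flip l0 b1)) i1' ->
       (i1 = j /\ i1' = j') \/ (i1 = j' /\ i1' = j)) ->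
    star_center (y b0) j -> star_center (y (flip l0 b0)) j'.
  move=> S h; have [i hi] := ex (flip l0 b0).
  by have [[_ <-//]|[E]] := S _ _ _ h hi; rewrite E eqxx in jj'.
have to_j l0 b0 : (forall b1 i1 i1', star_center (y b1) i1 -> star_center (y (flip l0 b1)) i1' ->
       (i1 = j /\ i1' = j') \/ (i1 = j' /\ i1' = j)) ->
    star_center (y b0) j' -> star_center (y (flip l0 b0)) j.
  move=> S h; have [i hi] := ex (flip l0 b0).
  by have [[E]|[_ <-//]] := S _ _ _ h hi; rewrite E eqxx in jj'.
have X l0 : l0 != c -> star_center (y (flip l0 b)) j' ->
    edge_val (y b) j p = 2 * (-1) ^+ b l0 * edge_val (a l0) j p.
  by move=> lc0 h; rewrite (yE l0) // (star_center_eq0 h) // add0r.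
(* Each single flip from [b] sends the entry at [(j, p)] to 0, so each subtracts the same value [x].
   Performing all three moves the centre to [j'] and the entry to [x - 3 x]. *)
have Xk := X _ kc bj'; have Xl := X _ lc (to_j' _ _ Sl bj); have Xm := X _ mc (to_j' _ _ Sm bj).
have b3 := to_j' _ _ Sm (to_j _ _ Sl bj').
have := star_center_eq0 b3 jj' pj'.
have Em := yE m (flip l (flip k b)) j p mc; have El := yE l (flip k b) j p lc.
have Ek := yE k b j p kc.
have fm : flip l (flip k b) m = b m.
  by rewrite /flip (negPf mk) [m == l]eq_sym (negPf lm) !addbF.
have fl : flip k b l = b l by rewrite /flip (negPf lk) addbF.
rewrite fm in Em; rewrite fl in El.
move=> z; move: Em; rewrite z add0r -Xm => Em; move: El; rewrite Em -Xl => El.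
move: Ek; rewrite El -Xk => /eqP.
rewrite -subr_eq0 (_ : _ - _ = - (2 * edge_val (y b) j p)); last by ring.
by rewrite oppr_eq0 mulf_eq0 pnatr_eq0 /= (negPf (star_center_neq0 bj pj)).
Qed.

(** The image of a unit vector at [c] is half the difference of two stars with the same centre
    [j]. *)
Lemma aut_star (R : realType) n (A B : cmat R n) (c : 'I_n) :
  (4 < n)%N -> flat_aut A B ->
  exists j, star_center (mat_apply A (star_vec R c pred0)) j /\
    forall k p q, k != c -> p != j -> q != j ->
      edge_val (mat_apply A (unit_vec R c k)) p q = 0.
Proof.
move=> n4 autA; have [j cj] := star_center_aut c pred0 n4 autA.
exists j; split=> // k p q kc pj qj.
have [j' cj'] := star_center_aut c (flip k pred0) n4 autA.
have jj' := star_center_flip n4 autA kc cj cj'; subst j'.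
have := aut_flip A pred0 p q kc.
rewrite (star_center_eq0 cj) // (star_center_eq0 cj') // add0r mulr1 => /esym/eqP.
by rewrite mulf_eq0 pnatr_eq0 => /eqP.
Qed.

(** * Reading off the vertex permutation and the scalar *)

Lemma edge_of_pair n (i j : 'I_n) : i != j ->
  exists f : edge n, val f = (i, j) \/ val f = (j, i).
Proof.
move: i j; apply: edge_ind => [i j [f Hf]|f]; first by exists f; case: Hf; [right|left].
by exists f; left; rewrite -surjective_pairing.
Qed.

Lemma mat_entry (R : realType) n (A : cmat R n) (e f : edge n) :
  A e f = edge_val (mat_apply A (unit_vec R (val f).1 (val f).2)) (val e).1 (val e).2.
Proof. by rewrite edge_valE mat_apply_unit. Qed.

Lemma edge_neq n (e : edge n) : (val e).1 != (val e).2.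
Proof. by have := valP e; rewrite neq_ltn => ->. Qed.

Lemma edge_image_inj n (s : 'I_n -> 'I_n) (e f g : edge n) :
  injective s ->
  ((s (val f).1, s (val f).2) == val e) || ((s (val f).2, s (val f).1) == val e) ->
  ((s (val g).1, s (val g).2) == val e) || ((s (val g).2, s (val g).1) == val e) ->
  f = g.
Proof.
move=> sI; have lt_f := valP f; have lt_g := valP g.
have crossed : (val g).2 = (val f).1 -> (val g).1 = (val f).2 -> f = g.
  move=> E1 E2; move: lt_g; rewrite /= E1 E2 => /(ltn_trans lt_f).
  by rewrite ltnn.
case/orP=> /eqP<-; rewrite !xpair_eqE !(inj_eq sI) => /orP[]/andP[/eqP E1 /eqP E2].
- by apply: val_inj; rewrite [val f]surjective_pairing [val g]surjective_pairing E1 E2.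
- exact: crossed.
- exact: crossed.
- by apply: val_inj; rewrite [val f]surjective_pairing [val g]surjective_pairing E1 E2.
Qed.

(** The unit vector of an edge is a unit vector at both of its ends, so its image is supported on
    the one edge joining the two image centres. *)
Lemma aut_perm (R : realType) n (A B : cmat R n) :
  (4 < n)%N -> flat_aut A B ->
  exists (sigma : {perm 'I_n}) (mu : R[i]),
    [/\ mu != 0, forall e f, perm_edge_entry R sigma e f = 0 -> A e f = 0 &
        forall e f, perm_edge_entry R sigma e f = 1 -> A e f ^+ 2 = mu].
Proof.
move=> n4 autA; have autB := flat_aut_sym autA.
have [s sP] := choice (fun c => aut_star c n4 autA).
have [s' s'P] := choice (fun c => aut_star c n4 autB).
(* [A] sends the unit vector of the edge [c m] to edges at [s c], and [B] sends these to edges at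
   [s' (s c)]. So [s' (s c)] lies on the edge [c m] for every [m], and two choices of [m] leave only
   [c]. *)
have ss' : cancel s s'.
  move=> c; have [k [l [m3 [ul K L _]]]] := three_others c c n4.
  have kl : k != l by move: ul; rewrite /= !inE negb_or => /andP[/andP[]].
  rewrite !inE orbb in K; rewrite !inE orbb in L.
  have hit m : m != c -> (c == s' (s c)) || (m == s' (s c)).
    move=> mc; apply/negPn/negP; rewrite negb_or => /andP[N1 N2].
    have : edge_val (unit_vec R c m) c m = 0.
      have cm : c != m by rewrite eq_sym.
      have [f Hf] := edge_of_pair cm.
      suff z : unit_vec R c m f = 0.
        case: Hf => Hf; have := edge_valE (unit_vec R c m) f; rewrite Hf /= z //.
        by rewrite edge_valC.
      have [/= AK _ _] := autA; rewrite -[unit_vec R c m]AK {1}/mat_apply.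
      apply: big1 => g _.
      have [gs|gs] := boolP (((val g).1 == s c) || ((val g).2 == s c)); last first.
        rewrite negb_or in gs; case/andP: gs => g1 g2.
        by rewrite -(edge_valE (mat_apply A _)) (sP c).2 ?mulr0.
      rewrite mat_entry; set z := edge_val _ _ _; suff -> : z = 0 by rewrite mul0r.
      have f1 : (val f).1 != s' (s c) by case: Hf => ->.
      have f2 : (val f).2 != s' (s c) by case: Hf => ->.
      rewrite /z; have gn := edge_neq g; case/orP: gs => /eqP g1.
        by rewrite g1 (s'P (s c)).2 // -g1 eq_sym.
      by rewrite unit_vecC g1 (s'P (s c)).2 // -g1.
    rewrite unit_vecE; last by rewrite eq_sym.
    by rewrite !eqxx => /eqP; rewrite oner_eq0.
  have /orP[/eqP/esym//|/eqP E1] := hit _ K; have /orP[/eqP/esym//|/eqP E2] := hit _ L.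
  by rewrite E1 E2 eqxx in kl.
pose sigma := perm (can_inj ss').
pose hit (e f : edge n) := ((s (val f).1, s (val f).2) == val e) ||
   ((s (val f).2, s (val f).1) == val e).
have entryE e f : perm_edge_entry R sigma e f = (hit e f)%:R.
  by rewrite /perm_edge_entry !permE.
have entry e f : ~~ hit e f -> A e f = 0.
  move=> nh; apply/eqP/negPn; apply: contraNN nh.
  rewrite mat_entry => nz; have fn := edge_neq f; have en := edge_neq e.
  have sn : s (val f).1 != s (val f).2 by rewrite (inj_eq (can_inj ss')).
  have t1 : ((val e).1 == s (val f).1) || ((val e).2 == s (val f).1).
    apply: contraNT nz; rewrite negb_or => /andP[N1 N2].
    by rewrite (sP (val f).1).2 // eq_sym.
  have t2 : ((val e).1 == s (val f).2) || ((val e).2 == s (val f).2).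
    apply: contraNT nz; rewrite negb_or => /andP[N1 N2].
    by rewrite unit_vecC (sP (val f).2).2.
  rewrite /hit [val e]surjective_pairing !xpair_eqE.
  case/orP: t1 => /eqP E1; case/orP: t2 => /eqP E2.
  - by rewrite -E1 -E2 eqxx in sn.
  - by rewrite E1 E2 !eqxx.
  - by rewrite E1 E2 !eqxx orbT.
  - by rewrite -E1 -E2 eqxx in sn.
have hit_inj e f g : hit e f -> hit e g -> f = g.
  exact: edge_image_inj (can_inj ss').
have ex_mu c : exists mu : R[i], mu != 0 /\
    forall p q, edge_val (mat_apply A (star_vec R c pred0)) p q ^+ 2 =
      if (p == s c) (+) (q == s c) then mu else 0.
  by have [m m0 H] := (sP c).1; exists m.
have [mu muP] := choice ex_mu.
(* Row [e] of [A] has its only nonzero entry at [f], and the all-plus star at an end of [f] takes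
   the value 1 there. *)
have sqrA e f c : hit e f -> (c == (val f).1) || (c == (val f).2) -> A e f ^+ 2 = mu c.
  move=> h cf; have sI := can_inj ss'.
  have -> : A e f = edge_val (mat_apply A (star_vec R c pred0)) (val e).1 (val e).2.
    rewrite edge_valE /mat_apply (bigD1 f) //= big1 ?addr0 => [|g gf]; last first.
      rewrite entry ?mul0r //; apply: contraNN gf => hg; apply/eqP.
      exact: hit_inj hg h.
    rewrite -(edge_valE (star_vec _ _ _) f) star_vecE ?edge_neq //.
    by case/orP: cf => /eqP <-; rewrite eqxx ?mulr1 //; case: ifP; rewrite mulr1.
  rewrite (muP c).2; case: ifP => // /negbT; have fn := edge_neq f.
  case/orP: h => /eqP <- /=; rewrite !(inj_eq sI); case/orP: cf => /eqP ->;
  by rewrite eqxx ?(negPf fn) // eq_sym (negPf fn).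
(* The entry of the edge joining [c] and [k] is seen by the stars at both of its ends. *)
have mu_const c k : mu c = mu k.
  have [->//|ck] := eqVneq c k; have [f Hf] := edge_of_pair ck.
  have sck : s (val f).1 != s (val f).2 by rewrite (inj_eq (can_inj ss')) edge_neq.
  have [e He] := edge_of_pair sck.
  have h : hit e f by rewrite /hit; case: He => ->; rewrite eqxx ?orbT.
  by rewrite -(sqrA e f c) -?(sqrA e f k) //; case: Hf => ->; rewrite /= eqxx ?orbT.
have c0 : 'I_n by apply: (@Ordinal n 0); apply: leq_trans n4.
exists sigma, (mu c0); split; first exact: (muP c0).1.
- move=> e f; rewrite entryE => /eqP; rewrite pnatr_eq0 eqb0; exact: entry.
- move=> e f; rewrite entryE; case: (boolP (hit e f)) => [h _|_ /eqP].
    by rewrite (sqrA e f (val f).1) ?eqxx.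
  by rewrite eq_sym oner_eq0.
Qed.

Theorem theorem5p7 (R : realType) (d : nat) (hd : (3 <= d)%N)
  (A : cmat R (d + 2)) :
  lin_aut d A ->
  exists (c : R[i]) (S : edge (d + 2) -> R[i]) (sigma : {perm 'I_(d + 2)}),
    [/\ c != 0,
        (forall e, S e = 1 \/ S e = -1)
      & (forall e f, A e f = c * (S e * perm_edge_entry R sigma e f))].
Proof.
move=> /lin_aut_flat[B autA]; have n4 : (4 < d + 2)%N by rewrite addn2.
have [sigma [mu [mu0 A0 A1]]] := aut_perm n4 autA.
have entryP e f : perm_edge_entry R sigma e f = 0 \/ perm_edge_entry R sigma e f = 1.
  by rewrite /perm_edge_entry; case: (_ || _); [right|left].
have c0 : sqrtC mu != 0 by rewrite sqrtC_eq0.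
have uniq_entry e f g : perm_edge_entry R sigma e f = 1 -> g != f ->
    perm_edge_entry R sigma e g = 0.
  move=> h gf; have [//|h'] := entryP e g; case/eqP: gf.
  have hitE f' : perm_edge_entry R sigma e f' = 1 ->
     ((sigma (val f').1, sigma (val f').2) == val e) ||
     ((sigma (val f').2, sigma (val f').1) == val e).
    by rewrite /perm_edge_entry; case: (_ || _) => // /eqP; rewrite eq_sym oner_eq0.
  exact: edge_image_inj perm_inj (hitE _ h') (hitE _ h).
have rowE e f : perm_edge_entry R sigma e f = 1 -> \sum_g A e g = A e f.
  move=> h; rewrite (bigD1 f) //= big1 ?addr0 // => g gf.
  by apply: A0; apply: uniq_entry h gf.
(* Each row has a single nonzero entry, of square [mu], so its row sum divided by [sqrtC mu] is the
   sign. *)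
exists (sqrtC mu), (fun e => (\sum_f A e f) / sqrtC mu), sigma; split=> // [e|e f].
  have sn : (sigma^-1)%g (val e).1 != (sigma^-1)%g (val e).2.
    by rewrite (inj_eq perm_inj) edge_neq.
  have [f Hf] := edge_of_pair sn.
  have h : perm_edge_entry R sigma e f = 1.
    rewrite /perm_edge_entry; case: Hf => -> /=; rewrite !permKV -surjective_pairing eqxx ?orbT //.
  rewrite (rowE e f h); apply/pred2P; rewrite -sqrf_eq1 expr_div_n sqrtCK A1 //.
  by rewrite divff.
have [h|h] := entryP e f; first by rewrite h mulr0 mulr0 A0.
by rewrite h mulr1 (rowE e f h) mulrC divfK.
Qed.
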